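(* On $T^*\mathbb{R}^2\equiv\mathbb{R}^4$ with canonical coordinates $(q_1,q_2,p_1,p_2)$ and canonical symplectic form $\omega=\mathrm{d}q_1\wedge\mathrm{d}p_1+\mathrm{d}q_2\wedge\mathrm{d}p_2$, consider the vector fields $$\begin{aligned} &\mathbf{X}_1=q_1\partial_{q_1}-p_1\partial_{p_1},\quad \mathbf{X}_2=q_1\partial_{q_2}-p_2\partial_{p_1},\quad \mathbf{X}_3=q_2\partial_{q_1}-p_1\partial_{p_2},\quad \mathbf{X}_4=q_2\partial_{q_2}-p_2\partial_{p_2},\\ &\mathbf{X}_5=-q_1\partial_{p_1},\quad \mathbf{X}_6=-q_2\partial_{p_1}-q_1\partial_{p_2},\quad \mathbf{X}_7=-q_2\partial_{p_2},\\ &\mathbf{X}_8=p_1\partial_{q_1},\quad \mathbf{X}_9=p_2\partial_{q_1}+p_1\partial_{q_2},\quad \mathbf{X}_{10}=p_2\partial_{q_2}, \end{aligned}$$ and the time-dependent vector field $\mathbf{X}=\sum_{\alpha=1}^{10}b_\alpha(t)\mathbf{X}_\alpha$ with $b_\alpha\in C^\infty(\mathbb{R})$. Then $\mathbf{X}$ is a Lie--Hamilton system on $(T^*\mathbb{R}^2,\omega)$ whose Vessiot--Guldberg Lie algebra, spanned by $\mathbf{X}_1,\dots,\mathbf{X}_{10}$, is isomorphic to $\mathfrak{sp}(4,\mathbb{R})$. Hamiltonian functions $h_\alpha$ with $\iota_{\mathbf{X}_\alpha}\omega=\mathrm{d}h_\alpha$ are $$h_1=q_1p_1,\ h_2=q_1p_2,\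 h_3=q_2p_1,\ h_4=q_2p_2,\ h_5=\tfrac12q_1^2,\ h_6=q_1q_2,\ h_7=\tfrac12q_2^2,\ h_8=\tfrac12p_1^2,\ h_9=p_1p_2,\ h_{10}=\tfrac12p_2^2,$$ and they span, under the Poisson bracket of $\omega$, a Lie algebra isomorphic to $\mathfrak{sp}(4,\mathbb{R})$. Moreover this system is intrinsic: it is not locally diffeomorphic to a Lie system on $\mathbb{R}^n$ for any $1\le n\le3$, and it is not locally diffeomorphic to an uncoupled sum of Lie systems on $\mathbb{R}^2$ or on $\mathbb{R}$.
   Context: A Lie system on $\mathbb{R}^n$ is a time-dependent vector field $\sum_{\alpha=1}^r b_\alpha(t)\mathbf{X}_\alpha$ where the vector fields $\mathbf{X}_1,\dots,\mathbf{X}_r$ span an $r$-dimensional real Lie algebra $V^X$, its Vessiot--Guldberg (VG) Lie algebra. It is a Lie--Hamilton system with respect to a symplectic form $\omega$ if all $\mathbf{X}_\alpha$ are Hamiltonian, i.e. $\iota_{\mathbf{X}_\alpha}\omega=\mathrm{d}h_\alpha$. The Poisson bracket is $\{f_1,f_2\}_\omega=\mathbf{X}_{f_2}f_1$, where $\iota_{\mathbf{X}_f}\omega=\mathrm{d}f$. Here $\mathfrak{sp}(4,\mathbb{R})=\{A\in\mathfrak{gl}(4,\mathbb{R}):A^TJ+JA=0\}$ with $J=\begin{pmatrix}0&\mathrm{Id}_2\\-\mathrm{Id}_2&0\end{pmatrix}$. Uncoupled sum: if $\mathbf{Y}$ and $\mathbf{Z}$ are Lie systems on $\mathbb{R}^p$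 and $\mathbb{R}^q$ whose VG Lie algebras are both isomorphic to the same Lie algebra $\mathfrak{g}$, spanned by $\mathbf{Y}_1,\dots,\mathbf{Y}_r$ and $\mathbf{Z}_1,\dots,\mathbf{Z}_r$ (corresponding to the same basis of $\mathfrak{g}$), their uncoupled sum $\mathbf{Y}+_{\mathrm{u}}\mathbf{Z}$ is the Lie system on $\mathbb{R}^{p+q}=\mathbb{R}^p\times\mathbb{R}^q$ with VG Lie algebra (isomorphic to $\mathfrak{g}$) spanned by $\mathbf{Y}_\alpha+\mathbf{Z}_\alpha$, with $\mathbf{Y}_\alpha$ acting on the first factor and $\mathbf{Z}_\alpha$ on the second; uncoupled sums of several systems are defined inductively. Two Lie systems on spaces of equal dimension are locally diffeomorphic if there is a diffeomorphism between nonempty open subsets of their domains whose push-forward carries the VG Lie algebra of one onto that of the other. For $m<n$, a Lie system $\mathbf{Y}$ on $\mathbb{R}^m$ is locally diffeomorphic to a Lie system $\mathbf{X}$ on $\mathbb{R}^n$ if $\mathbf{X}$ can be reduced by invariants to a Lie system on (an open subset of) $\mathbb{R}^m$ that is locally diffeomorphic to $\mathbf{Y}$. Reduction by invariants: let $\mathcal{D}^X_\xi=\{\mathbf{Z}|_\xi:\mathbf{Z}\in V^X\}$ have maximal rank $k<n$, attained on the open set $U$. Take (locally on $U$) $n-k$ functionally independent functions $\varphi_i$ with $\mathbf{X}_\alpha(\varphi_i)=0$ for all $\alpha,i$, a nonempty regular level set $\psi^{-1}(\lambda)$ of $\psi=(\varphi_1,\dots,\varphi_{n-k})$, and a diffeomorphism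 $\phi:W'\to W$ from an open set $W'\subset\mathbb{R}^k$ onto an open set $W\subset\psi^{-1}(\lambda)$; the reduced Lie system on $W'\subset\mathbb{R}^k$ is $\sum_\alpha b_\alpha(t)(\phi^{-1})_*(\mathbf{X}_\alpha)$, with VG Lie algebra $(\phi^{-1})_*(V^X)$. *)

(* Defs.v *)
From HB Require Import structures.
From mathcomp Require Import all_boot all_order all_algebra.
From mathcomp Require Import all_classical all_reals all_analysis.

Set Implicit Arguments.
Unset Strict Implicit.
Unset Printing Implicit Defensive.

Import Order.TTheory GRing.Theory Num.Theory.
Import numFieldNormedType.Exports.

Local Open Scope classical_set_scope.
Local Open Scope ring_scope.

(* C^k maps on an open set U; only used for finite-dimensional V, where the
   continuity of all directional derivatives is that of the differential. *)
Fixpoint Ck_on (R : realType) (V W : normedModType R) (k : nat)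
    (U : set V) (f : V -> W) : Prop :=
  match k with
  | 0 => forall x, U x -> {for x, continuous f}
  | k'.+1 => (forall x, U x -> differentiable f x) /\
             (forall v, Ck_on k' U (fun x => 'D_v f x))
  end.

Definition smooth_on (R : realType) (V W : normedModType R)
    (U : set V) (f : V -> W) : Prop :=
  forall k, Ck_on k U f.

(* Smoothness on an arbitrary subset B, e.g. a submanifold: local existence of
   smooth extensions.  For B open this is equivalent to smooth_on B g. *)
Definition smooth_on_subset (R : realType) (V W : normedModType R)
    (B : set V) (g : V -> W) : Prop :=
  forall y, B y -> exists (N : set V) (G : V -> W),
    [/\ open N, N y, smooth_on N G & forall z, N z -> B z -> G z = g z].

(* f is a diffeomorphism with inverse g from the open set A onto B, where B is
   an open set or an embedded submanifold. *)
Definition diffeomorphism (R : realType) (V W : normedModType R)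
    (A : set V) (B : set W) (f : V -> W) (g : W -> V) : Prop :=
  [/\ open A, smooth_on A f & smooth_on_subset B g] /\
  [/\ forall x, A x -> B (f x), forall y, B y -> A (g y),
      forall x, A x -> g (f x) = x & forall y, B y -> f (g y) = y].

Definition spanned (R : realType) (L : lmodType R) (r : nat)
    (e : 'I_r -> L) : set L :=
  [set v | exists c : 'I_r -> R, v = \sum_(i < r) c i *: e i].

Definition lin_indep (R : realType) (L : lmodType R) (r : nat)
    (e : 'I_r -> L) : Prop :=
  forall c : 'I_r -> R, \sum_(i < r) c i *: e i = 0 -> forall i, c i = 0.

Definition is_basis (R : realType) (L : lmodType R) (g : set L) (r : nat)
    (e : 'I_r -> L) : Prop :=
  lin_indep e /\ g = spanned e.

(* br is only required to behave as a Lie bracket on g. *)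
Definition is_lie_algebra (R : realType) (L : lmodType R)
    (br : L -> L -> L) (g : set L) : Prop :=
  [/\ g 0,
      forall (a : R) x y, g x -> g y -> g (a *: x + y) &
      forall x y, g x -> g y -> g (br x y)] /\
  [/\ forall (a : R) x y z, g x -> g y -> g z ->
        br (a *: x + y) z = a *: br x z + br y z,
      forall (a : R) x y z, g x -> g y -> g z ->
        br z (a *: x + y) = a *: br z x + br z y,
      forall x, g x -> br x x = 0 &
      forall x y z, g x -> g y -> g z ->
        br x (br y z) + br y (br z x) + br z (br x y) = 0].

Definition lie_isomorphism (R : realType) (L1 L2 : lmodType R)
    (br1 : L1 -> L1 -> L1) (g1 : set L1)
    (br2 : L2 -> L2 -> L2) (g2 : set L2) (Phi : L1 -> L2) : Prop :=
  [/\ set_bij g1 g2 Phi,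
      forall (a : R) x y, g1 x -> g1 y ->
        Phi (a *: x + y) = a *: Phi x + Phi y &
      forall x y, g1 x -> g1 y -> Phi (br1 x y) = br2 (Phi x) (Phi y)].

Definition lie_isomorphic (R : realType) (L1 L2 : lmodType R)
    (br1 : L1 -> L1 -> L1) (g1 : set L1)
    (br2 : L2 -> L2 -> L2) (g2 : set L2) : Prop :=
  exists Phi : L1 -> L2, lie_isomorphism br1 g1 br2 g2 Phi.

Definition J4 (R : realType) : 'M[R]_(2 + 2) :=
  block_mx 0 1%:M (- 1%:M) 0.

Definition sp4 (R : realType) : set 'M[R]_(2 + 2) :=
  [set A | A^T *m J4 R + J4 R *m A = 0].

Definition mx_commutator (R : realType) (n : nat) (A B : 'M[R]_n) : 'M[R]_n :=
  A *m B - B *m A.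

Notation vfield R n := ('rV[R]_n -> 'rV[R]_n).

(* In coordinates, [X, Y]^i = X(Y^i) - Y(X^i). *)
Definition lie_bracket (R : realType) (n : nat) (X Y : vfield R n)
    : vfield R n :=
  fun x => 'd Y x (X x) - 'd X x (Y x).

(* The data of a time-dependent vector field \sum_a b_a(t) X_a. *)
Record system (R : realType) (n : nat) := System {
  sys_dim : nat;
  sys_coef : 'I_sys_dim -> R -> R;
  sys_vf : 'I_sys_dim -> vfield R n
}.
Arguments System {R n sys_dim} sys_coef sys_vf.
Arguments sys_coef {R n} s a t : rename.
Arguments sys_vf {R n} s a x : rename.

Definition VG (R : realType) (n : nat) (S : system R n) : set (vfield R n) :=
  spanned (sys_vf S).

Definition is_lie_system (R : realType) (n : nat) (S : system R n) : Prop :=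
  [/\ forall a, smooth_on setT (sys_coef S a),
      forall a, smooth_on setT (sys_vf S a),
      lin_indep (sys_vf S) &
      is_lie_algebra (@lie_bracket R n) (VG S)].

Definition form2 (R : realType) (n : nat) :=
  'rV[R]_n -> 'rV[R]_n -> 'rV[R]_n -> R.

(* The last clause is d omega = 0, evaluated on constant vector fields. *)
Definition is_symplectic (R : realType) (n : nat) (omega : form2 R n) : Prop :=
  [/\ forall x v (a : R) u u',
        omega x (a *: u + u') v = a * omega x u v + omega x u' v,
      forall x v, omega x v v = 0 &
      forall u v, smooth_on setT (fun x => omega x u v)] /\
  [/\ forall x u, (forall v, omega x u v = 0) -> u = 0 &
      forall x u v w,
        'D_u (fun y => omega y v w) x - 'D_v (fun y => omega y u w) x
        + 'D_w (fun y => omega y u v) x = 0].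

(* iota_X omega = dh *)
Definition hamiltonian_for (R : realType) (n : nat) (omega : form2 R n)
    (X : vfield R n) (h : 'rV[R]_n -> R) : Prop :=
  smooth_on setT h /\ forall x v, omega x (X x) v = 'd h x v.

Definition is_lie_hamilton (R : realType) (n : nat) (omega : form2 R n)
    (S : system R n) : Prop :=
  [/\ is_symplectic omega, is_lie_system S &
      forall a, exists h, hamiltonian_for omega (sys_vf S a) h].

(* The vector field X_f with iota_{X_f} omega = df; it exists and is unique
   when omega is symplectic. *)
Definition ham_vfield (R : realType) (n : nat) (omega : form2 R n)
    (f : 'rV[R]_n -> R) : vfield R n :=
  fun x => xget 0 [set u | forall v, omega x u v = 'd f x v].

(* {f1, f2} = X_{f2} f1 *)
Definition poisson (R : realType) (n : nat) (omega : form2 R n)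
    (f1 f2 : 'rV[R]_n -> R) : 'rV[R]_n -> R :=
  fun x => 'd f1 x (ham_vfield omega f2 x).

Definition vf_dsum (R : realType) (p q : nat) (Y : vfield R p)
    (Z : vfield R q) : vfield R (p + q) :=
  fun x => row_mx (Y (lsubmx x)) (Z (rsubmx x)).

(* S is an uncoupled sum of Y and Z.  Only the VG Lie algebra of S is
   prescribed, its time-dependent coefficients are left free. *)
Definition is_uncoupled_sum2 (R : realType) (p q : nat) (Y : system R p)
    (Z : system R q) (S : system R (p + q)) : Prop :=
  [/\ is_lie_system Y, is_lie_system Z & is_lie_system S] /\
  exists (L : lmodType R) (br : L -> L -> L) (g : set L)
         (PhiY : L -> vfield R p) (PhiZ : L -> vfield R q)
         (r : nat) (e : 'I_r -> L),
    [/\ is_lie_algebra br g, is_basis g e,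
        lie_isomorphism br g (@lie_bracket R p) (VG Y) PhiY,
        lie_isomorphism br g (@lie_bracket R q) (VG Z) PhiZ &
        VG S = spanned (fun a => vf_dsum (PhiY (e a)) (PhiZ (e a)))].

(* Iterated uncoupled sums, with any number of summands (possibly one), of Lie
   systems on R or R^2. *)
Inductive uncoupled_sum_low (R : realType) :
    forall n : nat, system R n -> Prop :=
  | UncoupledR (Y : system R 1) :
      is_lie_system Y -> uncoupled_sum_low Y
  | UncoupledR2 (Y : system R 2) :
      is_lie_system Y -> uncoupled_sum_low Y
  | UncoupledSum (p q : nat) (Y : system R p) (Z : system R q)
      (S : system R (p + q)) :
      uncoupled_sum_low Y -> uncoupled_sum_low Z ->
      is_uncoupled_sum2 Y Z S -> uncoupled_sum_low S.

(* The push-forward by f of the fields of V1, restricted to A, are exactly the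
   fields of V2, restricted to f(A). *)
Definition pushforward_onto (R : realType) (n m : nat) (A : set 'rV[R]_n)
    (f : 'rV[R]_n -> 'rV[R]_m) (V1 : set (vfield R n)) (V2 : set (vfield R m))
    : Prop :=
  (forall Z, V1 Z -> exists2 Z', V2 Z' &
     forall x, A x -> 'd f x (Z x) = Z' (f x)) /\
  (forall Z', V2 Z' -> exists2 Z, V1 Z &
     forall x, A x -> 'd f x (Z x) = Z' (f x)).

(* S1 lives on the open set D1 and S2 on the open set D2. *)
Definition locally_diffeo_eqdim (R : realType) (n m : nat)
    (D1 : set 'rV[R]_n) (S1 : system R n)
    (D2 : set 'rV[R]_m) (S2 : system R m) : Prop :=
  n = m /\
  exists (A : set 'rV[R]_n) (B : set 'rV[R]_m)
         (f : 'rV[R]_n -> 'rV[R]_m) (g : 'rV[R]_m -> 'rV[R]_n),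
    [/\ A `<=` D1, A !=set0, open B & B `<=` D2] /\
    [/\ diffeomorphism A B f g & pushforward_onto A f (VG S1) (VG S2)].

(* The dimension of the distribution D^X at x. *)
Definition vg_rank (R : realType) (n : nat) (S : system R n)
    (x : 'rV[R]_n) : nat :=
  \rank (\matrix_(a < sys_dim S) sys_vf S a x).

(* The differentials are independent at every point of O, so that every level
   set in O is regular. *)
Definition functionally_independent (R : realType) (n s : nat)
    (O : set 'rV[R]_n) (phi : 'I_s -> 'rV[R]_n -> R) : Prop :=
  forall x, O x -> forall c : 'I_s -> R,
    (forall v, \sum_(i < s) c i * 'd (phi i) x v = 0) -> forall i, c i = 0.

(* S, on R^n, reduces by invariants to the system on the open set W' of R^k
   with the same coefficients and the vector fields X'.  W is the image of the
   parametrisation theta of an open piece of a level set of the invariants phi;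
   the last clause says X'_a = (theta^{-1})_* X_a. *)
Definition reduces_by_invariants (R : realType) (n k : nat) (S : system R n)
    (W' : set 'rV[R]_k) (X' : 'I_(sys_dim S) -> vfield R k) : Prop :=
  [/\ (k < n)%N,
      forall x, (vg_rank S x <= k)%N &
      exists (O : set 'rV[R]_n) (phi : 'I_(n - k) -> 'rV[R]_n -> R)
             (lam : 'I_(n - k) -> R) (G W : set 'rV[R]_n)
             (theta : 'rV[R]_k -> 'rV[R]_n) (eta : 'rV[R]_n -> 'rV[R]_k),
        [/\ open O, O !=set0 & O `<=` [set x | vg_rank S x = k]] /\
        [/\ forall i, smooth_on O (phi i),
            functionally_independent O phi &
            forall i a x, O x -> 'd (phi i) x (sys_vf S a x) = 0] /\
        [/\ open G,
            W = [set x | O x /\ forall i, phi i x = lam i] `&` G,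
            W !=set0, diffeomorphism W' W theta eta &
            forall a w, W' w ->
              'd theta w (X' a w) = sys_vf S a (theta w)]].

Arguments reduces_by_invariants {R n k} S W' X'.

(* The case k < n: S reduces to a system on an open set of R^k which is locally
   diffeomorphic to the system Y. *)
Definition locally_diffeo_reduced (R : realType) (k n : nat)
    (Y : system R k) (S : system R n) : Prop :=
  exists (W' : set 'rV[R]_k) (X' : 'I_(sys_dim S) -> vfield R k),
    reduces_by_invariants S W' X' /\
    locally_diffeo_eqdim W' (System (sys_coef S) X') setT Y.

(* In unequal dimensions the system on the larger space is the one that gets
   reduced; the relation is symmetric. *)
Definition locally_diffeomorphic (R : realType) (n m : nat)
    (S1 : system R n) (S2 : system R m) : Prop :=
  [\/ locally_diffeo_eqdim setT S1 setT S2,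
      (n < m)%N /\ locally_diffeo_reduced S1 S2 |
      (m < n)%N /\ locally_diffeo_reduced S2 S1].

(* Coordinates are ordered as (q1, q2, p1, p2). *)
Definition cq1 (R : realType) (x : 'rV[R]_4) : R := x 0 0.
Definition cq2 (R : realType) (x : 'rV[R]_4) : R := x 0 1.
Definition cp1 (R : realType) (x : 'rV[R]_4) : R := x 0 2.
Definition cp2 (R : realType) (x : 'rV[R]_4) : R := x 0 3.

Definition vec4 (R : realType) (a b c d : R) : 'rV[R]_4 :=
  \row_(j < 4) [:: a; b; c; d]`_j.

Definition omega_can (R : realType) : form2 R 4 := fun _ u v =>
  (cq1 u * cp1 v - cp1 u * cq1 v) + (cq2 u * cp2 v - cp2 u * cq2 v).

Definition vfX (R : realType) (a : 'I_10) : vfield R 4 := fun x =>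
  let q1 := cq1 x in let q2 := cq2 x in let p1 := cp1 x in let p2 := cp2 x in
  [:: vec4 q1 0 (- p1) 0;
      vec4 0 q1 (- p2) 0;
      vec4 q2 0 0 (- p1);
      vec4 0 q2 0 (- p2);
      vec4 0 0 (- q1) 0;
      vec4 0 0 (- q2) (- q1);
      vec4 0 0 0 (- q2);
      vec4 p1 0 0 0;
      vec4 p2 p1 0 0;
      vec4 0 p2 0 0]`_a.

Definition hamX (R : realType) (a : 'I_10) : 'rV[R]_4 -> R := fun x =>
  let q1 := cq1 x in let q2 := cq2 x in let p1 := cp1 x in let p2 := cp2 x in
  [:: q1 * p1;
      q1 * p2;
      q2 * p1;
      q2 * p2;
      2^-1 * q1 ^+ 2;
      q1 * q2;
      2^-1 * q2 ^+ 2;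
      2^-1 * p1 ^+ 2;
      p1 * p2;
      2^-1 * p2 ^+ 2]`_a.

(* Main.v *)
From HB Require Import structures.
Require Import Defs.
From mathcomp Require Import all_boot all_order all_algebra.
From mathcomp Require Import zify ring lra.
From mathcomp Require Import all_classical all_reals all_analysis.
Import Order.TTheory GRing.Theory Num.Theory.
Import numFieldNormedType.Exports.
Local Open Scope classical_set_scope.
Local Open Scope ring_scope.

Set Implicit Arguments.
Unset Strict Implicit.
Unset Printing Implicit Defensive.

(** The fields are the linear fields x |-> x A with A in sp(4), and h_A(x) =
    x A J x^T / 2 is Hamiltonian for x A, which gives the two isomorphisms.

    The fields span the whole tangent space away from the origin, so the system
    admits no reduction by invariants.  Suppose now that an uncoupled sum Y is
    locally diffeomorphic to it, possibly after a reduction.  This gives an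
    immersion F of an open subset of R^4 such that every field of sp(4) is
    F-related to a field of VG(Y).  Let P be a subalgebra of VG(Y), of minimal
    dimension among those whose fields are still related to all of sp(4).  The
    fields of P whose component in one of the summands R or R^2 of Y vanishes at
    a given point form a subalgebra of codimension at most 2 in P; its image in
    sp(4) is a subalgebra of codimension at most 2, hence everything, so by
    minimality it is P.  Therefore all fields of P vanish identically, which
    contradicts that F is an immersion.

    That sp(4) has no proper subalgebra of codimension at most 2 is seen on the
    leading terms with respect to a grading separating the roots: at most two
    roots are missing among the leading terms; a short root is a sum of two roots
    in two disjoint ways, so it is not missing, and the other roots and the
    Cartan subalgebra are obtained from brackets of short and long roots. *)

(** * Subalgebras of sp(4) of codimension at most two *)

Lemma forall_ord4 (P : 'I_4 -> Prop) :
  P 0 -> P 1 -> P 2 -> P 3 -> forall i, P i.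
Proof.
move=> P0 P1 P2 P3 [[|[|[|[|//]]]] lti].
- by rewrite (_ : Ordinal lti = 0) //; apply: val_inj.
- by rewrite (_ : Ordinal lti = 1) //; apply: val_inj.
- by rewrite (_ : Ordinal lti = 2) //; apply: val_inj.
- by rewrite (_ : Ordinal lti = 3) //; apply: val_inj.
Qed.

Lemma sum_ord4 (V : nmodType) (F : 'I_4 -> V) :
  \sum_(i < 4) F i = F 0 + F 1 + F 2 + F 3.
Proof.
rewrite !big_ord_recl big_ord0 addr0 !addrA.
by congr (F _ + F _ + F _ + F _); apply: val_inj.
Qed.

Section Sp4.
Variable R : realType.
Implicit Types (A B M x : 'M[R]_4) (H : set 'M[R]_4).

Lemma J4E (i j : 'I_4) :
  J4 R i j = (j == i + 2 :> nat)%N%:R - (i == j + 2 :> nat)%N%:R.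
Proof.
case: (split_ordP (i : 'I_(2 + 2))) => k ->;
  case: (split_ordP (j : 'I_(2 + 2))) => l ->;
  have := ltn_ord k; have := ltn_ord l;
  rewrite /J4 ?(block_mxEul, block_mxEur, block_mxEdl, block_mxEdr) !mxE /=
    -?val_eqE /= => ? ?.
- by case: eqP => ?; [lia|case: eqP => ?; [lia|rewrite subrr]].
- rewrite (addnC 2) eqn_add2r eq_sym.
  by case: (_ =P (_ + _ + _)%N) => ?; [lia|rewrite subr0].
- case: (_ =P (_ + _ + _)%N) => ?; first by lia.
  by rewrite sub0r (addnC 2) eqn_add2r.
- by case: eqP => ?; [lia|case: eqP => ?; [lia|rewrite subrr]].
Qed.

(** An explicit rewriting table, so that matrix identities involving [J4] reduce to [ring] or [lra]
    entry by entry. *)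
Lemma J4_table :
  ((J4 R 0 0 = 0) * (J4 R 0 1 = 0) * (J4 R 0 2 = 1) * (J4 R 0 3 = 0))
* ((J4 R 1 0 = 0) * (J4 R 1 1 = 0) * (J4 R 1 2 = 0) * (J4 R 1 3 = 1))
* ((J4 R 2 0 = -1) * (J4 R 2 1 = 0) * (J4 R 2 2 = 0) * (J4 R 2 3 = 0))
* ((J4 R 3 0 = 0) * (J4 R 3 1 = -1) * (J4 R 3 2 = 0) * (J4 R 3 3 = 0)).
Proof.
by do ! split; rewrite J4E; first [exact: subrr | exact: subr0 | exact: sub0r].
Qed.

(** In 2 x 2 blocks the lower right block is minus the transpose of the upper left one, and the two
    off-diagonal blocks are symmetric. *)
Lemma sp4P A :
  sp4 A <-> [/\ A 2 2 = - A 0 0, A 3 3 = - A 1 1, A 2 3 = - A 1 0 &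
                A 3 2 = - A 0 1] /\ [/\ A 0 3 = A 1 2 & A 2 1 = A 3 0].
Proof.
have E (i j : 'I_4) : (A^T *m J4 R + J4 R *m A) i j =
    (A 0 i * J4 R 0 j + A 1 i * J4 R 1 j + A 2 i * J4 R 2 j + A 3 i * J4 R 3 j)
  + (J4 R i 0 * A 0 j + J4 R i 1 * A 1 j + J4 R i 2 * A 2 j + J4 R i 3 * A 3 j).
  by rewrite 3!mxE !sum_ord4 !mxE.
split=> [sA|[[e1 e2 e3 e4] [e5 e6]]].
  have {}E i j := etrans (esym (E i j)) (congr1 (fun B : 'M[R]_4 => B i j) sA).
  (* The matrix [A^T *m J4 R + J4 R *m A] is antisymmetric, so its six entries above the diagonal
     carry all the information. *)
  have := E 0 2; have := E 1 3; have := E 0 3; have := E 1 2.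
  have := E 2 3; have := E 0 1; rewrite !J4_table !mxE /=.
  move=> *; split; split; lra.
apply/matrixP => i j; rewrite [LHS]E [RHS]mxE.
by elim/forall_ord4: i; elim/forall_ord4: j;
  rewrite !J4_table ?e1 ?e2 ?e3 ?e4 ?e5 ?e6; ring.
Qed.

Lemma mulmx4E m p (A : 'M[R]_(m, 4)) (B : 'M[R]_(4, p)) i j : (A *m B) i j =
  A i 0 * B 0 j + A i 1 * B 1 j + A i 2 * B 2 j + A i 3 * B 3 j.
Proof. by rewrite mxE sum_ord4. Qed.

Lemma sp4_comb (a : R) A B : sp4 A -> sp4 B -> sp4 (a *: A + B).
Proof.
move=> /sp4P[[e1 e2 e3 e4] [e5 e6]] /sp4P[[f1 f2 f3 f4] [f5 f6]]; apply/sp4P.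
by rewrite !mxE e1 e2 e3 e4 e5 e6 f1 f2 f3 f4 f5 f6; split; split; ring.
Qed.

Lemma sp4_comm A B : sp4 A -> sp4 B -> sp4 (mx_commutator A B).
Proof.
move=> /sp4P[[e1 e2 e3 e4] [e5 e6]] /sp4P[[f1 f2 f3 f4] [f5 f6]]; apply/sp4P.
have E i j : mx_commutator A B i j = (A *m B) i j - (B *m A) i j by rewrite !mxE.
rewrite !E !mulmx4E e1 e2 e3 e4 e5 e6 f1 f2 f3 f4 f5 f6.
by split; split; ring.
Qed.

Definition wt (i : 'I_4) : int := [:: 3; 2; - 3%:Z; - 2%:Z]`_i.

(* The filtration of gl_4 by the eigenvalues of ad diag(3, 2, -3, -2), which
   separate the eight roots of sp_4. *)
Definition filt (k : int) A := forall i j, k < wt i - wt j -> A i j = 0.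

Lemma filt_le k l A : k <= l -> filt k A -> filt l A.
Proof. by move=> kl Ak i j lij; apply: Ak; apply: le_lt_trans lij. Qed.

Lemma filt_comb k (a : R) A B : filt k A -> filt k B -> filt k (a *: A + B).
Proof. by move=> Ak Bk i j kij; rewrite !mxE Ak // Bk // mulr0 addr0. Qed.

Lemma filt0 k : filt k 0.
Proof. by move=> i j _; rewrite mxE. Qed.

Lemma filtZ k (a : R) A : filt k A -> filt k (a *: A).
Proof.
by move=> fA; rewrite -[_ *: _]addr0; apply: filt_comb => //; apply: filt0.
Qed.

Lemma filtB k A B : filt k A -> filt k B -> filt k (A - B).
Proof. by move=> Ak Bk i j kij; rewrite !mxE Ak // Bk // subr0. Qed.

(** If [wt i - wt j] exceeds [k + l], then for every middle index one of the two factors has an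
    entry beyond its own bound. *)
Lemma filt_mul k l A B : filt k A -> filt l B -> filt (k + l) (A *m B).
Proof.
move=> Ak Bl i j klij; rewrite mxE big1 // => m _.
have [kim|kim] := ltP k (wt i - wt m); first by rewrite Ak ?mul0r.
by rewrite Bl ?mulr0 //; move: klij kim; lia.
Qed.

Lemma filt_commutator k l A B :
  filt k A -> filt l B -> filt (k + l) (mx_commutator A B).
Proof.
by move=> fA fB; apply: filtB; [exact: filt_mul|rewrite addrC; exact: filt_mul].
Qed.

(** * Root vectors of sp(4) and their brackets *)

Let E (i j : 'I_4) : 'M[R]_4 := delta_mx i j.

(** The positive root vectors are [r1], [r3] (long, weights 6 and 4) and [r2], [r4] (short, weights
    5 and 1). Each [s] is the transpose of the corresponding [r] and has the opposite weight; [t1]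
    and [t2] span the Cartan subalgebra. *)
Let r1 := E 0 2.
Let r2 := E 0 3 + E 1 2.
Let r3 := E 1 3.
Let r4 := E 0 1 - E 3 2.
Let s1 := E 2 0.
Let s2 := E 3 0 + E 2 1.
Let s3 := E 3 1.
Let s4 := E 1 0 - E 2 3.
Let t1 := E 0 0 - E 2 2.
Let t2 := E 1 1 - E 3 3.

Let sp4_root : [/\ sp4 r1, sp4 r2, sp4 r3 & sp4 r4] /\
               [/\ sp4 s1, sp4 s2, sp4 s3 & sp4 s4].
Proof.
by split; split; apply/sp4P; rewrite !mxE /= ?(subr0, sub0r, addr0, add0r, oppr0).
Qed.

Let filt_root : [/\ filt 6 r1, filt 5 r2, filt 4 r3 & filt 1 r4] /\
  [/\ filt (- 6%:Z) s1, filt (- 5%:Z) s2, filt (- 4%:Z) s3 & filt (- 1%:Z) s4].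
Proof.
by split; split; elim/forall_ord4; elim/forall_ord4; rewrite /wt //= => _;
  rewrite !mxE /= ?(subr0, sub0r, addr0, add0r, oppr0).
Qed.

Ltac commutator_delta := rewrite /mx_commutator
  !(mulmxDl, mulmxDr, mulNmx, mulmxN, mul_delta_mx_cond) /=
  ?(mulr0n, mulr1n); apply/matrixP => i j; rewrite !mxE; ring.

(** The first eight brackets produce each of the four short root vectors in two ways, the next two
    produce the Cartan subalgebra, and the last four produce the long root vectors from short
    ones. *)
Let c_r1s4 : mx_commutator r1 s4 = (-1) *: r2.
Proof. commutator_delta. Qed.

Let c_r3r4 : mx_commutator r3 r4 = (-1) *: r2.
Proof. by commutator_delta. Qed.

Let c_s1r4 : mx_commutator s1 r4 = (1) *: s2.
Proof. by commutator_delta. Qed.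

Let c_s3s4 : mx_commutator s3 s4 = (1) *: s2.
Proof. by commutator_delta. Qed.

Let c_r1s2 : mx_commutator r1 s2 = (1) *: r4.
Proof. by commutator_delta. Qed.

Let c_r2s3 : mx_commutator r2 s3 = (1) *: r4.
Proof. by commutator_delta. Qed.

Let c_s1r2 : mx_commutator s1 r2 = (-1) *: s4.
Proof. by commutator_delta. Qed.

Let c_s2r3 : mx_commutator s2 r3 = (-1) *: s4.
Proof. by commutator_delta. Qed.

Let c_r1s1 : mx_commutator r1 s1 = 1 *: t1.
Proof. by commutator_delta. Qed.

Let c_r3s3 : mx_commutator r3 s3 = 1 *: t2.
Proof. by commutator_delta. Qed.

Let c_r2r4 : mx_commutator r2 r4 = (-2) *: r1.
Proof. by commutator_delta. Qed.

Let c_r2s4 : mx_commutator r2 s4 = (-2) *: r3.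
Proof. by commutator_delta. Qed.

Let c_s2s4 : mx_commutator s2 s4 = (2) *: s1.
Proof. by commutator_delta. Qed.

Let c_s2r4 : mx_commutator s2 r4 = (2) *: s3.
Proof. by commutator_delta. Qed.

(** Some element of [H] agrees with [A] up to terms of weight below [k]; the zero matrix is allowed,
    so the leading terms of weight [k] form a subspace. *)
Definition lead H (k : int) A := filt k A /\ exists2 x, H x & filt (k - 1) (x - A).

(** * Leading terms of a subalgebra of codimension at most two *)

Section Subalgebra.
Variable H : set 'M[R]_4.
Hypothesis H_sp4 : H `<=` @sp4 R.
Hypothesis H0 : H 0.
Hypothesis H_comb : forall (a : R) A B, H A -> H B -> H (a *: A + B).
Hypothesis H_comm : forall A B, H A -> H B -> H (mx_commutator A B).
(** Codimension at most two, phrased as linear dependence modulo [H] of any three elements. *)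
Hypothesis H_codim : forall A1 A2 A3, sp4 A1 -> sp4 A2 -> sp4 A3 ->
  exists2 a : R * R * R, a != 0 & H (a.1.1 *: A1 + a.1.2 *: A2 + a.2 *: A3).

Lemma lead_comb k (a : R) A B :
  lead H k A -> lead H k B -> lead H k (a *: A + B).
Proof.
move=> [fA [x Hx fx]] [fB [y Hy fy]]; split; first exact: filt_comb.
exists (a *: x + y); first exact: H_comb.
have -> : a *: x + y - (a *: A + B) = a *: (x - A) + (y - B).
  by rewrite scalerBr; apply/matrixP => i j; rewrite !mxE; ring.
exact: filt_comb.
Qed.

Lemma leadZ k (a : R) A : lead H k A -> lead H k (a *: A).
Proof.
move=> hA; rewrite -[a *: A]addr0; apply: lead_comb => //.
by split; [exact: filt0|exists 0; rewrite ?subr0 //; exact: filt0].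
Qed.

(** With representatives [x] and [y], [x, y] - [A, B] = [x - A, y] + [A, y - B], and both terms have
    weight below [k + l]. *)
Lemma lead_commutator k l A B :
  lead H k A -> lead H l B -> lead H (k + l) (mx_commutator A B).
Proof.
move=> [fA [x Hx fx]] [fB [y Hy fy]]; split; first exact: filt_commutator.
exists (mx_commutator x y); first exact: H_comm.
have -> : mx_commutator x y - mx_commutator A B =
    mx_commutator (x - A) y + mx_commutator A (y - B).
  rewrite /mx_commutator !(mulmxBl, mulmxBr).
  by apply/matrixP => i j; rewrite !mxE; ring.
have fy' : filt l y.
  rewrite -[y](subrK B) -[y - B]scale1r; apply: filt_comb fB.
  by apply: filt_le fy; lia.
rewrite -[X in filt _ (X + _)]scale1r; apply: filt_comb.
  by have := filt_commutator fx fy'; rewrite addrAC.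
by have := filt_commutator fA fy; rewrite addrA.
Qed.

Lemma lead_scaled k (a : R) A B :
  a != 0 -> filt k A -> filt (k - 1) B -> H (a *: A + B) -> lead H k A.
Proof.
move=> a0 fA fB HAB; split=> //.
exists (a^-1 *: (a *: A + B)).
  by rewrite -[_ *: _]addr0; apply: H_comb.
rewrite scalerDr scalerA mulVf // scale1r addrAC subrr add0r.
exact: filtZ.
Qed.

(** In a nontrivial combination lying in [H], the term of greatest weight with nonzero coefficient
    is the leading one. *)
Lemma lead_one_of_three k1 k2 k3 A1 A2 A3 :
    k3 < k2 < k1 -> sp4 A1 -> sp4 A2 -> sp4 A3 ->
    filt k1 A1 -> filt k2 A2 -> filt k3 A3 ->
  [\/ lead H k1 A1, lead H k2 A2 | lead H k3 A3].
Proof.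
move=> /andP[k32 k21] p1 p2 p3 f1 f2 f3.
have [[[a1 a2] a3] /= a0 Ha] := H_codim p1 p2 p3.
have [a10|a10] := eqVneq a1 0; last first.
  apply: Or31; apply: (lead_scaled a10 f1 _ (B := a2 *: A2 + a3 *: A3)).
    apply: filt_comb; first by apply: filt_le f2; lia.
    by apply: filtZ; apply: filt_le f3; lia.
  by rewrite addrA.
rewrite a10 scale0r add0r in Ha; have [a20|a20] := eqVneq a2 0; last first.
  apply: Or32; apply: (lead_scaled a20 f2 _ Ha).
  by apply: filtZ; apply: filt_le f3; lia.
rewrite a20 scale0r add0r in Ha; have [a30|a30] := eqVneq a3 0.
  by case/eqP: a0; rewrite a10 a20 a30.
apply: Or33; apply: (lead_scaled a30 f3 (B := 0)); first exact: filt0.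
by rewrite addr0.
Qed.

Let lead_one_of k1 k2 k3 A1 A2 A3 :
    k1 != k2 -> k1 != k3 -> k2 != k3 ->
    sp4 A1 -> sp4 A2 -> sp4 A3 -> filt k1 A1 -> filt k2 A2 -> filt k3 A3 ->
  [\/ lead H k1 A1, lead H k2 A2 | lead H k3 A3].
Proof.
move=> n12 n13 n23 p1 p2 p3 f1 f2 f3.
have [l12|l21|] := ltgtP k1 k2; last by move/eqP: n12.
  have [l13|l31|] := ltgtP k1 k3; last by move/eqP: n13.
    have [l23|l32|] := ltgtP k2 k3; last by move/eqP: n23.
      have l : k1 < k2 < k3 by rewrite l12 l23.
      by case: (lead_one_of_three l p3 p2 p1 f3 f2 f1) => ?; constructor.
    have l : k1 < k3 < k2 by rewrite l13 l32.
    by case: (lead_one_of_three l p2 p3 p1 f2 f3 f1) => ?; constructor.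
  have l : k3 < k1 < k2 by rewrite l31 l12.
  by case: (lead_one_of_three l p2 p1 p3 f2 f1 f3) => ?; constructor.
have [l13|l31|] := ltgtP k1 k3; last by move/eqP: n13.
  have l : k2 < k1 < k3 by rewrite l21 l13.
  by case: (lead_one_of_three l p3 p1 p2 f3 f1 f2) => ?; constructor.
have [l23|l32|] := ltgtP k2 k3; last by move/eqP: n23.
  have l : k2 < k3 < k1 by rewrite l23 l31.
  by case: (lead_one_of_three l p1 p3 p2 f1 f3 f2) => ?; constructor.
have l : k3 < k2 < k1 by rewrite l32 l21.
by case: (lead_one_of_three l p1 p2 p3 f1 f2 f3) => ?; constructor.
Qed.

Let lead_of_commutator k l m (c : R) A B C :
  c != 0 -> mx_commutator A B = c *: C -> k = l + m ->
  lead H l A -> lead H m B -> lead H k C.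
Proof.
move=> c0 AB -> lA lB; have := lead_commutator lA lB; rewrite AB => /(leadZ c^-1).
by rewrite scalerA mulVf // scale1r.
Qed.

(* A root that is a sum of two roots in two disjoint ways leads: otherwise it
   would be missing together with a summand of each decomposition. *)
Let lead_two_ways k l m l' m' (c c' : R) A B C B' C' :
  uniq [:: k; l; m; l'; m'] -> k = l + m -> k = l' + m' ->
  c != 0 -> c' != 0 ->
  mx_commutator B C = c *: A -> mx_commutator B' C' = c' *: A ->
  sp4 A -> sp4 B -> sp4 C -> sp4 B' -> sp4 C' ->
  filt k A -> filt l B -> filt m C -> filt l' B' -> filt m' C' ->
  lead H k A.
Proof.
rewrite /= !inE !negb_or -!andbA.
move=> /and5P[n1 n2 n3 n4 /and5P[n5 n6 n7 n8 /and3P[n9 n10 _]]].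
move=> e e' c0 c0' eBC eBC' pA pB pC pB' pC' fA fB fC fB' fC'.
have [//|nA] := pselect (lead H k A).
have dec m1 m2 (c1 : R) X Y : c1 != 0 -> mx_commutator X Y = c1 *: A ->
    k = m1 + m2 -> ~ lead H m1 X \/ ~ lead H m2 Y.
  move=> c10 eXY em; apply/not_andP => -[lX lY].
  exact/nA/(lead_of_commutator c10 eXY em).
have [nX|nX] := dec _ _ _ _ _ c0 eBC e;
  have [nY|nY] := dec _ _ _ _ _ c0' eBC' e'.
- by have [] := lead_one_of n1 n3 n6 pA pB pB' fA fB fB'.
- by have [] := lead_one_of n1 n4 n7 pA pB pC' fA fB fC'.
- by have [] := lead_one_of n2 n3 n8 pA pC pB' fA fC fB'.
- by have [] := lead_one_of n2 n4 n9 pA pC pC' fA fC fC'.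
Qed.

(** Short roots come first, through their two decompositions; every long root is then the sum of two
    short ones. *)
Let lead_root : [/\ lead H 6 r1, lead H 5 r2, lead H 4 r3 & lead H 1 r4] /\
  [/\ lead H (- 6%:Z) s1, lead H (- 5%:Z) s2, lead H (- 4%:Z) s3 &
      lead H (- 1%:Z) s4].
Proof.
have [[p1 p2 p3 p4] [q1 q2 q3 q4]] := sp4_root.
have [[f1 f2 f3 f4] [g1 g2 g3 g4]] := filt_root.
have l2 : lead H 5 r2.
  by apply: (lead_two_ways _ _ _ _ _ c_r1s4 c_r3r4 p2 _ _ _ _ f2 f1 g4 f3 f4);
    rewrite ?oppr_eq0 ?oner_eq0.
have m2 : lead H (- 5%:Z) s2.
  by apply: (lead_two_ways _ _ _ _ _ c_s1r4 c_s3s4 q2 _ _ _ _ g2 g1 f4 g3 g4);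
    rewrite ?oppr_eq0 ?oner_eq0.
have l4 : lead H 1 r4.
  by apply: (lead_two_ways _ _ _ _ _ c_r1s2 c_r2s3 p4 _ _ _ _ f4 f1 g2 f2 g3);
    rewrite ?oppr_eq0 ?oner_eq0.
have m4 : lead H (- 1%:Z) s4.
  by apply: (lead_two_ways _ _ _ _ _ c_s1r2 c_s2r3 q4 _ _ _ _ g4 g1 f2 g2 f3);
    rewrite ?oppr_eq0 ?oner_eq0.
have l1 : lead H 6 r1.
  by apply: (lead_of_commutator _ c_r2r4 _ l2 l4); rewrite ?oppr_eq0 ?pnatr_eq0.
have l3 : lead H 4 r3.
  by apply: (lead_of_commutator _ c_r2s4 _ l2 m4); rewrite ?oppr_eq0 ?pnatr_eq0.
have m1 : lead H (- 6%:Z) s1.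
  by apply: (lead_of_commutator _ c_s2s4 _ m2 m4); rewrite ?oppr_eq0 ?pnatr_eq0.
have m3 : lead H (- 4%:Z) s3.
  by apply: (lead_of_commutator _ c_s2r4 _ m2 l4); rewrite ?oppr_eq0 ?pnatr_eq0.
by [].
Qed.

Let H_full_filt k := forall A, sp4 A -> filt k A -> H A.

(** Subtracting an element of [H] with the same leading term moves an element of sp(4) one step down
    the filtration. *)
Let descent k :
  (forall A, sp4 A -> filt k A ->
     exists2 C, lead H k C & filt (k - 1) (A - C)) ->
  H_full_filt (k - 1) -> H_full_filt k.
Proof.
move=> leadk IH A sA fA; have [C [_ [x Hx fxC]] fAC] := leadk A sA fA.
have sx := H_sp4 Hx.
rewrite -[A](subrK x) -[A - x]scale1r; apply: H_comb Hx; apply: IH.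
  by rewrite addrC -scaleN1r; apply: sp4_comb sx sA.
rewrite (_ : A - x = (A - C) - (x - C)); first exact: filtB.
by apply/matrixP => i j; rewrite !mxE; ring.
Qed.

(** A degree that is not a difference of two weights contributes nothing to the filtration. *)
Let descent0 k :
  (forall i j, k <= wt i - wt j -> k < wt i - wt j) ->
  H_full_filt (k - 1) -> H_full_filt k.
Proof.
move=> gap IH A sA fA; apply: IH => // i j kij; apply/fA/gap.
by move: kij; lia.
Qed.

Ltac weight_gap := by elim/forall_ord4; elim/forall_ord4.

Ltac leading_entry fA e1 e2 e3 e4 e5 e6 :=
  elim/forall_ord4; elim/forall_ord4; rewrite // /wt /= => _;
  rewrite !mxE /= ?(mulr0, mulr1, subr0, addr0, add0r, sub0r) ?subrr
    ?e1 ?e2 ?e3 ?e4 ?e5 ?e6 ?mulrN1 ?opprK ?subrr ?addNr ?fA ?oppr0.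

Lemma sp4_subalgebra_codim2 : @sp4 R `<=` H.
Proof.
have [[l1 l2 l3 l4] [m1 m2 m3 m4]] := lead_root.
have lt1 : lead H 0 t1.
  by apply: (lead_of_commutator _ c_r1s1 _ l1 m1); rewrite ?oner_eq0.
have lt2 : lead H 0 t2.
  by apply: (lead_of_commutator _ c_r3s3 _ l3 m3); rewrite ?oner_eq0.
(* The largest difference of two weights is 6, so the filtration is exhausted there. *)
suff F6 : H_full_filt 6.
  move=> A sA; apply: F6 => //.
  by elim/forall_ord4; elim/forall_ord4.
apply: descent => [A sA fA|].
  exists (A 0 2 *: r1); first exact: leadZ.
  have [[e1 e2 e3 e4] [e5 e6]] := (sp4P _).1 sA.
  by leading_entry fA e1 e2 e3 e4 e5 e6.
apply: descent => [A sA fA|].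
  exists (A 0 3 *: r2); first exact: leadZ.
  have [[e1 e2 e3 e4] [e5 e6]] := (sp4P _).1 sA.
  by leading_entry fA e1 e2 e3 e4 e5 e6.
apply: descent => [A sA fA|].
  exists (A 1 3 *: r3); first exact: leadZ.
  have [[e1 e2 e3 e4] [e5 e6]] := (sp4P _).1 sA.
  by leading_entry fA e1 e2 e3 e4 e5 e6.
(* No root has weight 3 or 2. *)
apply: descent0; first by weight_gap.
apply: descent0; first by weight_gap.
apply: descent => [A sA fA|].
  exists (A 0 1 *: r4); first exact: leadZ.
  have [[e1 e2 e3 e4] [e5 e6]] := (sp4P _).1 sA.
  by leading_entry fA e1 e2 e3 e4 e5 e6.
(* Weight 0 is the Cartan subalgebra, the only graded piece of dimension two. *)
apply: (@descent 0) => [A sA fA|].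
  exists (A 0 0 *: t1 + A 1 1 *: t2); first by apply: lead_comb => //; apply: leadZ.
  have [[e1 e2 e3 e4] [e5 e6]] := (sp4P _).1 sA.
  by leading_entry fA e1 e2 e3 e4 e5 e6.
apply: descent => [A sA fA|].
  exists (A 1 0 *: s4); first exact: leadZ.
  have [[e1 e2 e3 e4] [e5 e6]] := (sp4P _).1 sA.
  by leading_entry fA e1 e2 e3 e4 e5 e6.
apply: descent0; first by weight_gap.
apply: descent0; first by weight_gap.
apply: descent => [A sA fA|].
  exists (A 3 1 *: s3); first exact: leadZ.
  have [[e1 e2 e3 e4] [e5 e6]] := (sp4P _).1 sA.
  by leading_entry fA e1 e2 e3 e4 e5 e6.
apply: descent => [A sA fA|].
  exists (A 3 0 *: s2); first exact: leadZ.
  have [[e1 e2 e3 e4] [e5 e6]] := (sp4P _).1 sA.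
  by leading_entry fA e1 e2 e3 e4 e5 e6.
apply: descent => [A sA fA|].
  exists (A 2 0 *: s1); first exact: leadZ.
  have [[e1 e2 e3 e4] [e5 e6]] := (sp4P _).1 sA.
  by leading_entry fA e1 e2 e3 e4 e5 e6.
(* Every difference of weights is at least -6, so degree -7 leaves only the zero matrix. *)
move=> A _ fA; suff -> : A = 0 by [].
by apply/matrixP; elim/forall_ord4; elim/forall_ord4; rewrite fA // mxE.
Qed.

End Subalgebra.
End Sp4.

(** * Young's theorem and related vector fields *)

Section Differentiability.
Variable R : realType.

(** The difference [g - f] vanishes near [x], hence is differentiable there with differential 0. *)
Lemma near_eq_differentiable (V W : normedModType R) (f g : V -> W) (x : V) :
  (\forall y \near x, f y = g y) -> differentiable f x -> differentiable g x.
Proof.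
move=> fg df; have -> : g = f + (g - f) by rewrite addrC subrK.
apply: differentiableD => //.
have e0 : \forall y \near x, (g - f) y = 0.
  by apply: filterS fg => y fgy; rewrite !fctE fgy subrr.
have cont0 : continuous (\0 : V -> W) by apply: cst_continuous.
have eo : (g - f) \o shift x = cst ((g - f) x) + (\0 : V -> W) +o_ 0 id.
  apply/eqaddoP => e e_gt0; have := e0; rewrite (near_shift 0) subr0.
  apply: filterS => h /= eh; rewrite -/((g - f) (h + x)).
  rewrite [X in `|X|](_ : _ = (g - f) (h + x) - ((g - f) x + 0)) //.
  by rewrite eh (nbhs_singleton e0) addr0 subrr normr0 mulr_ge0 // ltW.
by apply/diff_locallyP; rewrite (diff_unique (df := \0) cont0 eo); split.
Qed.

Lemma littleo_diff (V W : normedModType R) (f : V -> W) (a : V) (e : R) :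
  differentiable f a -> 0 < e -> exists2 d, 0 < d &
    forall h, `|h| < d -> `|f (h + a) - f a - 'd f a h| <= e * `|h|.
Proof.
move=> df e0; have /eqaddoP/(_ _ e0) := diff_locally df.
move=> /nbhs_ballP[d /= d0 hd]; exists d => // h hlt.
have := hd h; rewrite -ball_normE /= sub0r normrN => /(_ hlt).
rewrite [X in `|X| <= _ -> _](_ : _ = f (h + a) - (f a + 'd f a h)) //.
by rewrite opprD addrA.
Qed.

Lemma mulmxr_differentiable m n (A : 'M[R]_(m, n)) (x : 'rV[R]_m) :
  differentiable (fun y : 'rV[R]_m => y *m A) x.
Proof.
rewrite (_ : (fun _ => _) = \sum_(i < m) (fun y : 'rV[R]_m => y 0 i *: row i A)).
  by apply: differentiable_sum => i; apply/differentiableZl/differentiable_coord.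
by apply/funext => y; rewrite mulmx_sum_row fct_sumE.
Qed.

Lemma diff_mulmxr m n (A : 'M[R]_(m, n)) (x v : 'rV[R]_m) :
  'd (fun y : 'rV[R]_m => y *m A) x v = v *m A.
Proof.
have cA : continuous (mulmxr A : 'rV[R]_m -> 'rV[R]_n).
  by move=> y; apply/differentiable_continuous/mulmxr_differentiable.
by have -> := diff_lin x cA.
Qed.

Lemma diff_coord (V : normedModType R) n (f : V -> 'rV[R]_n) i (x v : V) :
  differentiable f x -> 'd (fun y => f y 0 i) x v = 'd f x v 0 i.
Proof.
move=> df; pose c (M : 'rV[R]_n) : R := M 0 i.
have dc y : differentiable c y := differentiable_coord y 0 i.
have clin : linear c by move=> a u w; rewrite /c !mxE.
pose cL := GRing.isLinear.Build _ _ _ _ _ clin.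
pose cl : {linear 'rV[R]_n -> R} := HB.pack c cL.
have cc : continuous cl by move=> y; exact/differentiable_continuous/dc.
rewrite -/(c _) (_ : (fun y => _) = c \o f) // (diff_comp df (dc _)) /=.
by rewrite (diff_lin _ cc).
Qed.

Lemma differentiable_coord_comp (V : normedModType R) n (f : V -> 'rV[R]_n) i x :
  differentiable f x -> differentiable (fun y => f y 0 i) x.
Proof.
by move=> df; have := differentiable_comp df (differentiable_coord (f x) 0 i).
Qed.

Lemma is_derive_line (V : normedModType R) (G : V -> R) (a u : V) (s : R) :
  differentiable G (s *: u + a) ->
  is_derive s 1 (fun t : R => G (t *: u + a)) ('D_u G (s *: u + a)).
Proof.
move=> dG; have dl : is_diff s (fun t : R => t *: u + a) (fun t => t *: u).
  rewrite (_ : (fun t => _) = ( *:%R^~ u) + cst a) //.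
  by apply: is_diff_eq; rewrite addr0.
have dGl : differentiable (fun t : R => G (t *: u + a)) s.
  exact: (differentiable_comp (@ex_diff _ _ _ _ _ _ _ dl)).
apply: DeriveDef; first exact: diff_derivable.
rewrite deriveE // (_ : (fun t : R => _) = G \o (fun t : R => t *: u + a)) //.
rewrite diff_comp //= ?(@diff_val _ _ _ _ _ _ _ dl) ?scale1r ?deriveE //.
Qed.

(** The mean value theorem is applied to [phi], the increment of [G] under translation by [t *: v],
    on the segment from 0 to [t]; the resulting increment of ['D_u G] is then expanded to first
    order at [a]. *)
Lemma second_difference (V : normedModType R) (G : V -> R) (a u v : V) (e : R) :
  (\forall x \near a, differentiable G x) -> differentiable ('D_u G) a ->
  0 < e -> exists2 d : R, 0 < d & forall t : R, 0 < t < d ->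
    `|G (t *: u + (t *: v + a)) - G (t *: u + a) - (G (t *: v + a) - G a)
      - t ^+ 2 * 'd ('D_u G) a v| <= e * t ^+ 2.
Proof.
move=> nearG dDu e0.
(* For [0 <= s <= t] the points [s *: u + t *: v] and [s *: u] have norm at most [t * N / 2]; with
   precision [e / N] each of the two remainders is at most [e * t / 2]. *)
set N := 2 * (`|u| + `|v| + 1).
have N0 : 0 < N by rewrite mulr_gt0 // ltr_wpDl // addr_ge0.
have [d1 d10 Hd1] := littleo_diff dDu (divr_gt0 e0 N0).
have [d2 /= d20 Hd2] := (nbhs_ballP _ _).1 nearG.
have dG h : `|h| < d2 -> differentiable G (h + a).
  move=> hd; apply: Hd2.
  by rewrite -ball_normE /= opprD addrA addrAC subrr add0r normrN.
exists (Num.min d1 d2 / N); first by rewrite divr_gt0 // lt_min d10.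
move=> t /andP[t0]; rewrite ltr_pdivlMr // lt_min => /andP[td1 td2].
have small s : 0 <= s <= t -> `|s *: u| + `|t *: v| <= t * N / 2.
  move=> /andP[s0 st]; rewrite !normrZ ger0_norm // (gtr0_norm t0) /N.
  have := ler_wpM2r (normr_ge0 u) st; have := normr_ge0 v; have := normr_ge0 u.
  by have := t0; nra.
have tN2 : t * N / 2 <= t * N.
  by rewrite ler_pdivrMr // ler_peMr ?ler1n // mulr_ge0 // ltW.
have small2 s : 0 <= s <= t -> `|s *: u + t *: v| <= t * N / 2.
  by move=> /small; apply: le_trans; apply: ler_normD.
have small1 s : 0 <= s <= t -> `|s *: u| <= t * N / 2.
  by move=> /small; apply: le_trans; rewrite lerDl.
pose phi (s : R) := G (s *: u + (t *: v + a)) - G (s *: u + a).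
pose dphi (s : R) := 'D_u G (s *: u + (t *: v + a)) - 'D_u G (s *: u + a).
have dphiP s : 0 <= s <= t -> is_derive s 1 phi (dphi s).
  move=> st; apply: is_deriveB; apply: is_derive_line.
    rewrite addrA; apply: dG; apply: le_lt_trans td2.
    by apply: le_trans tN2; apply: small2.
  by apply: dG; apply: le_lt_trans td2; apply: le_trans tN2; apply: small1.
have [s||c c0t] := @MVT R phi dphi 0 t t0.
- by rewrite in_itv /= => /andP[s0 st]; apply: dphiP; rewrite !ltW.
- apply: derivable_within_continuous => s; rewrite in_itv /= => st.
  by have := dphiP s st.
have {}c0t : 0 <= c <= t.
  by move: c0t; rewrite in_itv /= => /andP[c0 ct]; rewrite !ltW.
rewrite /phi scale0r !add0r subr0 => ->.
pose L := 'd ('D_u G) a; pose r h := 'D_u G (h + a) - 'D_u G a - L h.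
have rE : dphi c = r (c *: u + t *: v) - r (c *: u) + t * L v.
  rewrite /r /dphi addrA (linearD L) (linearZZ L t v) /GRing.scale /=; ring.
have rle h : `|h| <= t * N / 2 -> `|r h| <= e * t / 2.
  move=> hle; apply: le_trans (Hd1 _ _) _.
    by apply: le_lt_trans td1; apply: le_trans tN2.
  have := ler_wpM2l (ltW (divr_gt0 e0 N0)) hle.
  by congr (_ <= _); field; rewrite gt_eqF.
have r1 := rle _ (small2 _ c0t); have r2 := rle _ (small1 _ c0t).
rewrite rE (_ : _ - _ = t * (r (c *: u + t *: v) - r (c *: u))); last by ring.
rewrite normrM gtr0_norm //.
rewrite (_ : e * _ = t * (e * t / 2 + e * t / 2)); last by field.
by rewrite ler_pM2l // (le_trans (ler_normB _ _)) // lerD.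
Qed.

(* Young's theorem: both sides are limits of the second difference of G divided
   by the square of the step. *)
Lemma derive_comm (V : normedModType R) (G : V -> R) (a u v : V) :
  (\forall x \near a, differentiable G x) ->
  differentiable ('D_u G) a -> differentiable ('D_v G) a ->
  'D_v ('D_u G) a = 'D_u ('D_v G) a.
Proof.
move=> nearG dDu dDv; apply/eqP; rewrite -subr_eq0 -normr_le0 leNgt.
apply/negP => pos; set e := `|_| in pos.
have e4 : 0 < e / 4 by rewrite divr_gt0.
have [d1 d10 H1] := second_difference v nearG dDu e4.
have [d2 d20 H2] := second_difference u nearG dDv e4.
pose t := Num.min d1 d2 / 2.
have t0 : 0 < t by rewrite divr_gt0 // lt_min d10.
have td : t < Num.min d1 d2 by rewrite ltr_pdivrMr // ltr_pMr ?ltr1n // lt_min d10.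
move: td; rewrite lt_min => /andP[td1 td2].
have := H1 t; rewrite t0 td1 -(deriveE v dDu) => /(_ isT).
have := H2 t; rewrite t0 td2 -(deriveE u dDv) => /(_ isT).
rewrite (addrCA (t *: v)).
set x := G _; set y := G _; set z := G _; set w := G _.
set p := 'D_u _ _; set q := 'D_v _ _ => h1 h2.
have ee : e = `|q - p| by [].
have t2 : 0 < t ^+ 2 by rewrite exprn_gt0.
have := le_trans (ler_normB _ _) (lerD h1 h2).
rewrite (_ : _ - _ = t ^+ 2 * (q - p)); last by ring.
rewrite normrM (gtr0_norm t2) -ee (_ : _ + _ = t ^+ 2 * (e / 2)); last by field.
by rewrite ler_pM2l // leNgt ltr_pdivrMr // ltr_pMr // ltr1n.
Qed.

End Differentiability.

(** * Lie brackets of fields related by a map *)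

Section RelatedFields.
Variable R : realType.

(** The regularity under which [derive_comm] applies to all pairs of directions. *)
Definition twice_diff_at (V : normedModType R) (x : V) (G : V -> R) :=
  (\forall y \near x, differentiable G y) /\ forall v, differentiable ('D_v G) x.

Lemma near_eq_twice_diff (V : normedModType R) (x : V) (G H : V -> R) :
  (\forall y \near x, G y = H y) -> twice_diff_at x G -> twice_diff_at x H.
Proof.
move=> GH [dG ddG]; have GH2 := near_join GH; split.
  by near=> y; apply: (@near_eq_differentiable _ _ _ G); near: y.
move=> v; apply: near_eq_differentiable (ddG v).
by apply: filterS GH2 => y GHy; apply: near_eq_derive.
Unshelve. all: by end_near. Qed.

Lemma smooth_twice_diff (V : normedModType R) n (U : set V) (F : V -> 'rV[R]_n) x i :
  open U -> smooth_on U F -> U x -> twice_diff_at x (fun y => F y 0 i).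
Proof.
move=> oU /(_ 2) [dF] ddF Ux; have nU : nbhs x U := open_nbhs_nbhs (conj oU Ux).
split; first by apply: filterS nU => y Uy; apply/differentiable_coord_comp/dF.
move=> v; have [/(_ _ Ux) dv _] := ddF v.
apply: near_eq_differentiable (differentiable_coord_comp i dv).
apply: filterS nU => y Uy; have dFy := dF y Uy.
by rewrite !deriveE ?diff_coord //; apply: differentiable_coord_comp.
Qed.

Lemma diff_delta n (G : 'rV[R]_n -> R) (y u : 'rV[R]_n) : differentiable G y ->
  'd G y u = \sum_(j < n) u 0 j * 'D_(delta_mx 0 j) G y.
Proof.
move=> dG; rewrite [u in LHS]row_sum_delta linear_sum; apply: eq_bigr => j _.
by rewrite linearZ deriveE.
Qed.

Lemma derive_coord (V : normedModType R) n (f : V -> 'rV[R]_n) i (x v : V) :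
  differentiable f x -> 'D_v (fun y => f y 0 i) x = 'D_v f x 0 i.
Proof.
by move=> df; rewrite !deriveE ?diff_coord //; apply: differentiable_coord_comp.
Qed.

Lemma twice_diff_comp (V : normedModType R) n (g : V -> 'rV[R]_n)
    (G : 'rV[R]_n -> R) (x : V) :
  (\forall y \near x, differentiable g y) ->
  (forall j, twice_diff_at x (fun y => g y 0 j)) ->
  twice_diff_at (g x) G -> twice_diff_at x (G \o g).
Proof.
move=> dg ddg [dG ddG]; have dgx := nbhs_singleton dg.
have dGg : \forall y \near x, differentiable G (g y).
  have cg : g y @[y --> x] --> g x := differentiable_continuous dgx.
  exact: (cg [set y | differentiable G y]%classic dG).
split; first by apply: filterS2 dg dGg => y; apply: differentiable_comp.
(* Near [x] the chain rule writes the derivative of the composite along [v] as this sum of products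
   of differentiable functions. *)
move=> v; pose S := \sum_(j < n)
  ('D_v (fun y => g y 0 j) * ('D_(delta_mx 0 j) G \o g) : V -> R).
apply: (@near_eq_differentiable _ _ _ S).
  near=> y; have dgy : differentiable g y by near: y.
  have dGy : differentiable G (g y) by near: y.
  rewrite [RHS](deriveE v (differentiable_comp dgy dGy)) (diff_comp dgy dGy) /=.
  rewrite diff_delta // /S fct_sumE; apply: eq_bigr => j _.
  by rewrite -(deriveE v dgy) -(derive_coord j v dgy).
apply: differentiable_sum => j; apply: differentiableM; first by have [_] := ddg j.
by apply: (differentiable_comp dgx (ddG _)).
Unshelve. all: by end_near. Qed.

(* The derivative of y |-> 'd F y (X y) along w, read off a field Y related to
   X; only the first summand involves second derivatives of F. *)
Lemma derive_related n m (F : 'rV[R]_n -> 'rV[R]_m) (X : vfield R n)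
    (Y : vfield R m) x w i :
  (\forall y \near x, differentiable F y) ->
  twice_diff_at x (fun y => F y 0 i) ->
  differentiable X x -> differentiable Y (F x) ->
  (\forall y \near x, 'd F y (X y) = Y (F y)) ->
  'd Y (F x) ('d F x w) 0 i =
    'D_w ('D_(X x) (fun y => F y 0 i)) x + 'd F x ('d X x w) 0 i.
Proof.
move=> dF [dG ddG] dX dY rel; set G := fun y => F y 0 i in dG ddG *.
have dFx := nbhs_singleton dF.
have dYF := differentiable_comp dFx dY.
transitivity ('D_w (fun y => (Y \o F) y 0 i) x).
  have E1 : 'd (Y \o F) x w = 'd Y (F x) ('d F x w).
    exact: (congr1 (@^~ w) (diff_comp dFx dY)).
  have E2 : 'D_w (Y \o F) x = 'd Y (F x) ('d F x w) := etrans (deriveE w dYF) E1.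
  by rewrite -E2; exact: esym (derive_coord i w dYF).
pose e j : 'rV[R]_n := delta_mx 0 j.
(* Writing ['d F y (X y)] in coordinates makes the product rule available; one half of it
   differentiates the coefficients of [X], the other freezes them at [x]. *)
transitivity ('D_w (\sum_(j < n) ((fun y => X y 0 j) * 'D_(e j) G) : _ -> R) x).
  apply: near_eq_derive; near=> y; have dFy : differentiable F y by near: y.
  have dGy : differentiable G y by near: y.
  have rely : 'd F y (X y) = Y (F y) by near: y.
  by rewrite /= -rely -(diff_coord i (X y) dFy) (diff_delta _ dGy) fct_sumE.
have dXj j : differentiable (fun y => X y 0 j) x by exact: differentiable_coord_comp.
rewrite derive_sum; last first.
  by move=> j; apply: diff_derivable; apply: differentiableM.
under eq_bigr => j _.
  rewrite deriveM; [|exact: diff_derivable|exact: diff_derivable].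
  rewrite (derive_coord j w dX) (deriveE w dX).
  over.
rewrite big_split /=; congr (_ + _); last first.
  rewrite -(diff_coord i _ dFx) (diff_delta _ (nbhs_singleton dG)).
  by apply: eq_bigr => j _; rewrite [LHS]mulrC.
transitivity ('D_w (\sum_(j < n) (X x 0 j \*: 'D_(e j) G) : _ -> R) x).
  rewrite derive_sum => [|j]; last by apply/derivableZ/diff_derivable.
  by apply: eq_bigr => j _; rewrite deriveZ //; apply: diff_derivable.
apply: near_eq_derive; near=> y; have dGy : differentiable G y by near: y.
by rewrite (deriveE _ dGy) (diff_delta _ dGy) fct_sumE.
Unshelve. all: by end_near. Qed.

(** Applying [derive_related] to each half of the bracket leaves two second derivatives of [F],
    which cancel by symmetry. *)
Lemma lie_bracket_related n m (F : 'rV[R]_n -> 'rV[R]_m) (X1 X2 : vfield R n)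
    (Y1 Y2 : vfield R m) x :
  (\forall y \near x, differentiable F y) ->
  (forall i, twice_diff_at x (fun y => F y 0 i)) ->
  differentiable X1 x -> differentiable X2 x ->
  differentiable Y1 (F x) -> differentiable Y2 (F x) ->
  (\forall y \near x, 'd F y (X1 y) = Y1 (F y)) ->
  (\forall y \near x, 'd F y (X2 y) = Y2 (F y)) ->
  'd F x (lie_bracket X1 X2 x) = lie_bracket Y1 Y2 (F x).
Proof.
move=> dF ddF dX1 dX2 dY1 dY2 rel1 rel2; apply/rowP => i.
rewrite /lie_bracket linearB /= [LHS]mxE [RHS]mxE.
rewrite [in X in _ + X = _]mxE [in X in _ = _ + X]mxE.
rewrite -(nbhs_singleton rel1) -(nbhs_singleton rel2).
rewrite (derive_related (X1 x) dF (ddF i) dX2 dY2 rel2).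
rewrite (derive_related (X2 x) dF (ddF i) dX1 dY1 rel1).
have [dG ddG] := ddF i.
by rewrite (derive_comm dG (ddG _) (ddG _)); ring.
Qed.

End RelatedFields.

(** * Uncoupled sums and local diffeomorphisms *)

Section LinearFields.
Variable R : realType.

Definition linvf n (A : 'M[R]_n) : vfield R n := fun x => x *m A.

Lemma diff_linvf n (A : 'M[R]_n) x v : 'd (linvf A) x v = v *m A.
Proof. exact: diff_mulmxr. Qed.

(** Since matrices act on row vectors from the right, the bracket of linear fields is the commutator
    without a change of sign. *)
Lemma lie_bracket_linvf n (A B : 'M[R]_n) :
  lie_bracket (linvf A) (linvf B) = linvf (mx_commutator A B).
Proof.
apply/funext => x; transitivity (linvf A x *m B - linvf B x *m A).
  by congr (_ - _); exact: diff_linvf.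
by rewrite /linvf /mx_commutator mulmxBr !mulmxA.
Qed.

Lemma linvf_comb n (a : R) (A B : 'M[R]_n) :
  linvf (a *: A + B) = a *: linvf A + linvf B.
Proof. by apply/funext => x; rewrite /linvf mulmxDr -scalemxAr. Qed.

End LinearFields.

(** * Vanishing of related fields under separation by low-rank isotropy conditions *)

Section LowRank.
Variable R : realType.

Lemma vg_differentiable n (S : system R n) Z x :
  is_lie_system S -> VG S Z -> differentiable Z x.
Proof.
move=> [_ sS _ _] [c ->]; apply: differentiable_sum => i; apply: differentiableZ.
by have [dS _] := sS i 1%N; apply: dS.
Qed.

Definition isotropy_closed n (V : set (vfield R n)) (C : 'M[R]_n) :=
  forall X Z y, V X -> V Z -> X y *m C = 0 -> Z y *m C = 0 ->
    lie_bracket X Z y *m C = 0.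

(* The isotropy conditions X y *m C = 0 of codimension at most 2 that define
   subalgebras jointly separate the values of the fields; for an uncoupled sum
   the matrices C are the projections to the factors. *)
Definition low_rank_separated n (V : set (vfield R n)) :=
  forall v : 'rV[R]_n,
    (forall C : 'M[R]_n, (\rank C <= 2)%N -> isotropy_closed V C -> v *m C = 0) ->
    v = 0.

Section Vanishing.
Variables (n : nat) (S : system R n) (U : set 'rV[R]_4) (F : 'rV[R]_4 -> 'rV[R]_n).
Hypothesis lieS : is_lie_system S.
Hypothesis sepS : low_rank_separated (VG S).
Hypothesis openU : open U.
Hypothesis dF : forall x, U x -> differentiable F x.
Hypothesis ddF : forall x i, U x -> twice_diff_at x (fun y => F y 0 i).
Hypothesis onto : forall A, sp4 A -> exists2 Z, VG S Z &
  forall x, U x -> 'd F x (linvf A x) = Z (F x).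

Let r := sys_dim S.

Let field (c : 'rV[R]_r) : vfield R n := \sum_(i < r) c 0 i *: sys_vf S i.

Let fieldE c y : field c y = c *m \matrix_(i < r) sys_vf S i y.
Proof.
rewrite mulmx_sum_row /field fct_sumE; apply: eq_bigr => i _.
by rewrite rowK.
Qed.

Let VG_field c : VG S (field c).
Proof. by exists (c 0). Qed.

Let field_VG Z : VG S Z -> exists c, Z = field c.
Proof.
move=> [c ->]; exists (\row_i c i).
by apply: eq_bigr => i _; rewrite mxE.
Qed.

Let dfield c x : differentiable (field c) x.
Proof. exact: vg_differentiable (VG_field c). Qed.

Let rel c A := forall x, U x -> 'd F x (linvf A x) = field c (F x).

Let rel_comb a c d A B : rel c A -> rel d B -> rel (a *: c + d) (a *: A + B).
Proof.
move=> rA rB x Ux; rewrite fieldE mulmxDl -scalemxAl -!fieldE -rA // -rB //.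
by rewrite linvf_comb linearD linearZ.
Qed.

Let rel0 : rel 0 0.
Proof. by move=> x _; rewrite fieldE mul0mx /linvf mulmx0 linear0. Qed.

Let rel_commutator c d e A B : lie_bracket (field c) (field d) = field e ->
  rel c A -> rel d B -> rel e (mx_commutator A B).
Proof.
move=> cde rA rB x Ux; have nU : nbhs x U := open_nbhs_nbhs (conj openU Ux).
rewrite -lie_bracket_linvf -cde; apply: lie_bracket_related => //.
- by apply: filterS nU.
- by move=> i; apply: ddF.
- exact: mulmxr_differentiable.
- exact: mulmxr_differentiable.
- by apply: filterS nU.
- by apply: filterS nU.
Qed.

(** A subspace of [VG S] is encoded by the row space of coefficient vectors [P], so that its
    dimension is a matrix rank; [good] subspaces are the subalgebras still related to all of
    sp(4). *)
Let good (P : 'M[R]_r) :=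
  (forall c d : 'rV[R]_r, (c <= P)%MS -> (d <= P)%MS ->
     exists2 e : 'rV[R]_r, (e <= P)%MS & lie_bracket (field c) (field d) = field e) /\
  (forall A, sp4 A -> exists2 c : 'rV[R]_r, (c <= P)%MS & rel c A).

Let good1 : good 1%:M.
Proof.
split=> [c d _ _|A /onto[Z /field_VG[c ->] rc]]; last by exists c; rewrite ?submx1.
have [_ _ _ [[_ _ brS] _]] := lieS.
have [e ->] := field_VG (brS _ _ (VG_field c) (VG_field d)).
by exists e; rewrite ?submx1.
Qed.

(* Passing to the isotropy subalgebra P :&: ker costs at most two dimensions,
   so its image in sp4 is still everything. *)
Let good_isotropy P (C : 'M[R]_n) y :
  good P -> (\rank C <= 2)%N -> isotropy_closed (VG S) C ->
  good (P :&: kermx (\matrix_(i < r) sys_vf S i y *m C))%MS.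
Proof.
move=> [brP ontoP] rC isoC; set E := \matrix_(i < r) sys_vf S i y.
set P0 := (P :&: _)%MS.
have P0P (c : 'rV[R]_r) : (c <= P0)%MS = (c <= P)%MS && (c *m (E *m C) == 0).
  by rewrite sub_capmx; congr andb; apply/sub_kermxP/eqP.
have br0 c d : (c <= P0)%MS -> (d <= P0)%MS ->
    exists2 e : 'rV[R]_r, (e <= P0)%MS & lie_bracket (field c) (field d) = field e.
  rewrite !P0P !mulmxA -!fieldE => /andP[cP /eqP c0] /andP[dP /eqP d0].
  have [e eP cde] := brP _ _ cP dP; exists e => //.
  rewrite P0P eP mulmxA -fieldE -cde /=; apply/eqP.
  by apply: isoC.
(* The matrices related to some field of the isotropy subalgebra; the remaining half of [good]
   amounts to [H] being all of sp(4). *)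
split=> //; pose H := [set A | sp4 A /\ exists2 c, (c <= P0)%MS & rel c A].
suff sH : @sp4 R `<=` H by move=> A /sH[].
apply: sp4_subalgebra_codim2.
- by move=> A [].
- by split; [rewrite /sp4 /= trmx0 mul0mx mulmx0 addr0|exists 0; rewrite ?sub0mx].
- move=> a A B [sA [c cP rA]] [sB [d dP rB]]; split; first exact: sp4_comb.
  exists (a *: c + d); last exact: rel_comb.
  by rewrite addmx_sub // scalemx_sub.
- move=> A B [sA [c cP rA]] [sB [d dP rB]]; split; first exact: sp4_comm.
  have [e eP cde] := br0 _ _ cP dP.
  by exists e => //; apply: rel_commutator cde rA rB.
move=> A1 A2 A3 s1 s2 s3.
have [c1 c1P r1] := ontoP _ s1; have [c2 c2P r2] := ontoP _ s2.
have [c3 c3P r3] := ontoP _ s3.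
pose K : 'M[R]_(1 + (1 + 1), r) := col_mx c1 (col_mx c2 c3).
(* A product with [C] has rank at most 2 while [K] has three rows, so some nonzero combination of
   the three fields satisfies the isotropy condition at [y]. *)
have : kermx (K *m (E *m C)) != 0.
  rewrite -mxrank_eq0 mxrank_ker -lt0n subn_gt0 mulmxA.
  exact: leq_ltn_trans (mxrankM_maxr _ _) _.
move=> /rowV0Pn[a /sub_kermxP aK a0].
pose a1 := lsubmx a 0 0; pose a2 := lsubmx (rsubmx a) 0 0.
pose a3 := rsubmx (rsubmx a) 0 0.
(* The trailing 0 gives the sum the shape in which [rel_comb] and [sp4_comb] apply three times. *)
have aE : a *m K = a1 *: c1 + (a2 *: c2 + (a3 *: c3 + 0)).
  rewrite -[a in LHS]hsubmxK -[rsubmx a in LHS]hsubmxK !mul_row_col addr0.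
  rewrite [lsubmx a in LHS]mx11_scalar [lsubmx (rsubmx a) in LHS]mx11_scalar.
  by rewrite [rsubmx (rsubmx a) in LHS]mx11_scalar !mul_scalar_mx.
exists (a1, a2, a3).
  apply: contraNneq a0 => -[e1 e2 e3].
  rewrite -[a]hsubmxK -[rsubmx a]hsubmxK [lsubmx a]mx11_scalar.
  rewrite [lsubmx (rsubmx a)]mx11_scalar [rsubmx (rsubmx a)]mx11_scalar.
  by rewrite -/a1 -/a2 -/a3 e1 e2 e3 raddf0 !row_mx0.
have -> : a1 *: A1 + a2 *: A2 + a3 *: A3 = a1 *: A1 + (a2 *: A2 + (a3 *: A3 + 0)).
  by rewrite addr0 addrA.
split.
  apply: sp4_comb => //; apply: sp4_comb => //; apply: sp4_comb => //.
  by rewrite /sp4 /= trmx0 mul0mx mulmx0 addr0.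
exists (a *m K); last by rewrite aE; do 3! apply: rel_comb => //.
rewrite P0P -mulmxA aK eqxx andbT aE.
by rewrite !addmx_sub ?scalemx_sub ?sub0mx.
Qed.

Lemma diff_linvf_eq0 A x : sp4 A -> U x -> 'd F x (linvf A x) = 0.
Proof.
move=> sA Ux.
pose hasgood k := `[< exists2 P, good P & \rank P = k >].
have exg : exists k, hasgood k.
  by exists (\rank (1%:M : 'M[R]_r)); apply/asboolP; exists 1%:M.
case: (ex_minnP exg) => k /asboolP[P gP <-] minP.
have vanish (c : 'rV[R]_r) y : (c <= P)%MS -> field c y = 0.
  move=> cP; apply: sepS => C rC isoC.
  have gP0 := good_isotropy y gP rC isoC; set P0 := (P :&: _)%MS in gP0.
  (* The rank of [P] is minimal among good subspaces, so passing to the isotropy subalgebra loses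
     nothing. *)
  have PP0 : (P <= P0)%MS.
    rewrite -(geq_leqif (mxrank_leqif_sup (capmxSl _ _))).
    by apply: minP; apply/asboolP; exists P0.
  have := submx_trans cP PP0; rewrite sub_capmx => /andP[_ /sub_kermxP].
  by rewrite mulmxA -fieldE.
by have [c cP ->] := gP.2 _ sA; rewrite ?vanish.
Qed.

End Vanishing.
End LowRank.

(** * Separation for uncoupled sums *)

Section UncoupledSums.
Variable R : realType.

Lemma lie_bracket_eq0 n (X Z : vfield R n) y :
  X y = 0 -> Z y = 0 -> lie_bracket X Z y = 0.
Proof.
move=> X0 Z0; rewrite /lie_bracket X0 Z0.
transitivity (0 - 0 : 'rV[R]_n); last exact: subrr.
by congr (_ - _); exact: linear0.
Qed.

(** The identity matrix itself has rank at most 2, and the bracket of two fields vanishing at a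
    point vanishes there. *)
Lemma low_rank_separated_small n (V : set (vfield R n)) :
  (n <= 2)%N -> low_rank_separated V.
Proof.
move=> n2 v /(_ 1%:M); rewrite mxrank1 => /(_ n2); rewrite mulmx1; apply.
by move=> X Z y _ _; rewrite !mulmx1; apply: lie_bracket_eq0.
Qed.

Lemma diff_lsubmx_comp p q m (A : 'rV[R]_p -> 'rV[R]_m) (y v : 'rV[R]_(p + q)) :
  differentiable A (lsubmx y) ->
  'd (A \o lsubmx) y v = 'd A (lsubmx y) (lsubmx v).
Proof.
move=> dA; have E : 'd lsubmx y v = lsubmx v :> 'rV[R]_p.
  exact: (congr1 (@^~ v) (diff_lin y (@continuous_lsubmx R 1 p q))).
rewrite -[in RHS]E.
exact: (congr1 (@^~ v) (diff_comp (differentiable_lsubmx y) dA)).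
Qed.

Lemma diff_rsubmx_comp p q m (A : 'rV[R]_q -> 'rV[R]_m) (y v : 'rV[R]_(p + q)) :
  differentiable A (rsubmx y) ->
  'd (A \o rsubmx) y v = 'd A (rsubmx y) (rsubmx v).
Proof.
move=> dA; have E : 'd rsubmx y v = rsubmx v :> 'rV[R]_q.
  exact: (congr1 (@^~ v) (diff_lin y (@continuous_rsubmx R 1 p q))).
rewrite -[in RHS]E.
exact: (congr1 (@^~ v) (diff_comp (differentiable_rsubmx y) dA)).
Qed.

Lemma diff_vf_dsum p q (X : vfield R p) (Z : vfield R q) y v :
  differentiable (vf_dsum X Z) y ->
  differentiable X (lsubmx y) -> differentiable Z (rsubmx y) ->
  'd (vf_dsum X Z) y v =
    row_mx ('d X (lsubmx y) (lsubmx v)) ('d Z (rsubmx y) (rsubmx v)).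
Proof.
move=> dXZ dX dZ; rewrite -[LHS]hsubmxK; congr row_mx.
  have E : 'd lsubmx (vf_dsum X Z y) ('d (vf_dsum X Z) y v)
         = lsubmx ('d (vf_dsum X Z) y v).
    exact: (congr1 (@^~ _) (diff_lin _ (@continuous_lsubmx R 1 p q))).
  rewrite -[LHS]E -(diff_lsubmx_comp v dX).
  rewrite -[LHS](congr1 (@^~ v) (diff_comp dXZ (differentiable_lsubmx _))).
  by congr ('d _ y v); apply/funext => x; rewrite /= row_mxKl.
have E : 'd rsubmx (vf_dsum X Z y) ('d (vf_dsum X Z) y v)
       = rsubmx ('d (vf_dsum X Z) y v).
  exact: (congr1 (@^~ _) (diff_lin _ (@continuous_rsubmx R 1 p q))).
rewrite -[LHS]E -(diff_rsubmx_comp v dZ).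
rewrite -[LHS](congr1 (@^~ v) (diff_comp dXZ (differentiable_rsubmx _))).
by congr ('d _ y v); apply/funext => x; rewrite /= row_mxKr.
Qed.

Lemma is_lie_algebra_sum (L : lmodType R) br (g : set L) r
    (c : 'I_r -> R) (e : 'I_r -> L) :
  is_lie_algebra br g -> (forall i, g (e i)) -> g (\sum_(i < r) c i *: e i).
Proof.
move=> [[g0 gD _] _] ge; elim/big_rec: _ => // i x _ gx.
exact: gD.
Qed.

(** Both isomorphisms send the common basis into the respective VG algebras, which are closed under
    linear combinations. *)
Lemma uncoupled_sum2_split p q (Y : system R p) (Z : system R q)
    (S : system R (p + q)) X :
  is_uncoupled_sum2 Y Z S -> VG S X ->
  exists X1 X2, [/\ VG Y X1, VG Z X2 & X = vf_dsum X1 X2].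
Proof.
move=> [[lY lZ lS] [L [br [g [PhiY [PhiZ [r [e]]]]]]]].
move=> [_ [_ gE] [bY _ _] [bZ _ _] ->].
move=> [c ->].
have ge i : g (e i).
  rewrite gE; exists (fun j => (j == i)%:R); rewrite (bigD1 i) //= eqxx scale1r.
  by rewrite big1 ?addr0 // => j /negbTE ->; rewrite scale0r.
have [_ _ _ lieY] := lY; have [_ _ _ lieZ] := lZ.
exists (\sum_(i < r) c i *: PhiY (e i)), (\sum_(i < r) c i *: PhiZ (e i)); split.
- by apply: is_lie_algebra_sum lieY _ => i; have [+ _ _] := bY; apply.
- by apply: is_lie_algebra_sum lieZ _ => i; have [+ _ _] := bZ; apply.
apply/funext => y; rewrite /vf_dsum !fct_sumE.
apply/rowP => j; rewrite summxE.
case: (split_ordP j) => k ->; rewrite ?row_mxEl ?row_mxEr summxE;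
  apply: eq_bigr => i _; rewrite !scalrfctE [LHS]mxE [RHS]mxE.
- by rewrite row_mxEl.
- by rewrite row_mxEr.
Qed.

(** By induction on the sum: brackets are computed componentwise, so an isotropy condition on one
    factor extends to the product. *)
Lemma uncoupled_sum_separated n (Y : system R n) :
  uncoupled_sum_low Y -> is_lie_system Y /\ low_rank_separated (VG Y).
Proof.
elim=> {n Y} [Y lY|Y lY|p q Y Z S _ [lY sY] _ [lZ sZ] sumS].
- by split=> //; apply: low_rank_separated_small.
- by split=> //; apply: low_rank_separated_small.
have [[_ _ lS] _] := sumS; split=> // v hv.
have br X X' y : VG S X -> VG S X' -> exists X1 X1' X2 X2',
   [/\ X = vf_dsum X1 X2, X' = vf_dsum X1' X2',
       VG Y X1 /\ VG Y X1', VG Z X2 /\ VG Z X2' &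
   lie_bracket X X' y = row_mx (lie_bracket X1 X1' (lsubmx y))
                               (lie_bracket X2 X2' (rsubmx y))].
  move=> VX VX'.
  have [X1 [X2 [Y1 Z2 XE]]] := uncoupled_sum2_split sumS VX.
  have [X1' [X2' [Y1' Z2' XE']]] := uncoupled_sum2_split sumS VX'.
  exists X1, X1', X2, X2'; split=> //.
  have dX := vg_differentiable y lS VX; have dX' := vg_differentiable y lS VX'.
  rewrite {VX VX'}XE {}XE' in dX dX' *.
  have d1 := vg_differentiable (lsubmx y) lY Y1.
  have d2 := vg_differentiable (rsubmx y) lZ Z2.
  have d1' := vg_differentiable (lsubmx y) lY Y1'.
  have d2' := vg_differentiable (rsubmx y) lZ Z2'.
  have E1 := diff_vf_dsum (vf_dsum X1 X2 y) dX' d1' d2'.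
  have E2 := diff_vf_dsum (vf_dsum X1' X2' y) dX d1 d2.
  have dsumK (A : vfield R p) (B : vfield R q) :
      lsubmx (vf_dsum A B y) = A (lsubmx y) /\ rsubmx (vf_dsum A B y) = B (rsubmx y).
    by rewrite row_mxKl row_mxKr.
  rewrite (dsumK X1 X2).1 (dsumK X1 X2).2 in E1.
  rewrite (dsumK X1' X2').1 (dsumK X1' X2').2 in E2.
  apply: (etrans (congr2 (fun a b => a - b) E1 E2)).
  by rewrite opp_row_mx add_row_mx.
rewrite -[v]hsubmxK.
have -> : lsubmx v = 0.
  apply: sY => C rC isoC.
  (* Padding [C] with zero blocks preserves its rank and tests only the first component. *)
  have := hv (block_mx C 0 0 0); rewrite rank_diag_block_mx mxrank0 addn0.
  move=> /(_ rC) hC; suff /hC : isotropy_closed (VG S) (block_mx C 0 0 0).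
    rewrite -[v in X in X -> _]hsubmxK mul_row_block !mulmx0 !addr0 => e.
    by have := congr1 lsubmx e; rewrite row_mxKl linear0.
  move=> X X' y VX VX'.
  have [X1 [X1' [X2 [X2' [-> -> [Y1 Y1'] _ ->]]]]] := br X X' y VX VX'.
  rewrite /vf_dsum !mul_row_block !mulmx0 !addr0.
  move=> /(congr1 lsubmx); rewrite row_mxKl linear0 => e1.
  move=> /(congr1 lsubmx); rewrite row_mxKl linear0 => e2.
  by rewrite (isoC _ _ _ Y1 Y1' e1 e2) row_mx0.
have -> : rsubmx v = 0.
  apply: sZ => C rC isoC.
  have := hv (block_mx 0 0 0 C); rewrite rank_diag_block_mx mxrank0 add0n.
  move=> /(_ rC) hC; suff /hC : isotropy_closed (VG S) (block_mx 0 0 0 C).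
    rewrite -[v in X in X -> _]hsubmxK mul_row_block !mulmx0 !add0r => e.
    by have := congr1 rsubmx e; rewrite row_mxKr linear0.
  move=> X X' y VX VX'.
  have [X1 [X1' [X2 [X2' [-> -> _ [Z2 Z2'] ->]]]]] := br X X' y VX VX'.
  rewrite /vf_dsum !mul_row_block !mulmx0 !add0r.
  move=> /(congr1 rsubmx); rewrite row_mxKr linear0 => e1.
  move=> /(congr1 rsubmx); rewrite row_mxKr linear0 => e2.
  by rewrite (isoC _ _ _ Z2 Z2' e1 e2) row_mx0.
by rewrite row_mx0.
Qed.

End UncoupledSums.

(** * From local diffeomorphisms to immersions *)

Section LocalDiffeomorphisms.
Variable R : realType.

Lemma open_neq0 (U : set 'rV[R]_4) : open U -> U !=set0 -> exists2 x, U x & x != 0.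
Proof.
move=> oU [x Ux]; have [x0|] := eqVneq x 0; last by exists x.
have nU : nbhs (0 : 'rV[R]_4) U by rewrite -x0; exact: open_nbhs_nbhs.
pose v : 'rV[R]_4 := delta_mx 0 0.
have cont : (fun t : R => t *: v) t @[t --> 0] --> (0 : 'rV[R]_4).
  by rewrite -[X in _ --> X](scale0r v); exact: scalel_continuous.
have [e /= e0 he] := (nbhs_ballP _ _).1 (cont _ nU).
exists ((e / 2) *: v).
  apply: he; rewrite -ball_normE /= sub0r normrN gtr0_norm ?divr_gt0 //.
  by rewrite ltr_pdivrMr // ltr_pMr // ltr1n.
apply/eqP => /(congr1 (fun M : 'rV[R]_4 => M 0 0)); rewrite !mxE /= mulr1.
by apply/eqP; rewrite mulf_neq0 ?invr_eq0 ?pnatr_eq0 ?gt_eqF.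
Qed.

(** As [B] may be a submanifold, [g] need not be differentiable in the ambient space; a local smooth
    extension of it serves as left inverse. *)
Lemma diffeo_left_inverse (V W : normedModType R) (A : set V) (B : set W) f g x :
  diffeomorphism A B f g -> A x ->
  exists2 G, differentiable G (f x) & \forall y \near x, G (f y) = y.
Proof.
move=> [[oA sf sg] [fAB gBA gf fg]] Ax.
have [N [G [oN Nfx sG GE]]] := sg _ (fAB _ Ax).
have [dG _] := sG 1%N; have [df _] := sf 1%N; exists G; first exact: dG.
have cf : f y @[y --> x] --> f x := differentiable_continuous (df _ Ax).
have nA : nbhs x A := open_nbhs_nbhs (conj oA Ax).
have nN := cf _ (open_nbhs_nbhs (conj oN Nfx)).
by near=> y; rewrite GE ?gf //; [near: y|near: y|apply: fAB; near: y].
Unshelve. all: by end_near. Qed.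

(** When [B] is open, the local extension of [g] coincides with [g] near [y] and passes its
    regularity on. *)
Lemma diffeo_inverse (V : normedModType R) n (A : set 'rV[R]_n) (B : set V) f g y :
  diffeomorphism A B f g -> open B -> B y ->
  differentiable g y /\ forall i, twice_diff_at y (fun z => g z 0 i).
Proof.
move=> [[oA sf sg] _] oB By.
have [N [G [oN Ny sG GE]]] := sg _ By.
have near_eq : \forall z \near y, G z = g z.
  have nB := open_nbhs_nbhs (conj oB By); have nN := open_nbhs_nbhs (conj oN Ny).
  by apply: filterS2 nN nB => z; apply: GE.
split.
  by apply: near_eq_differentiable near_eq _; have [dG _] := sG 1%N; apply: dG.
move=> i; apply: (near_eq_twice_diff (G := fun z => G z 0 i)).
  by apply: filterS near_eq => z ->.
exact: smooth_twice_diff oN sG Ny.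
Qed.

Lemma diff_left_inverse (V W : normedModType R) (f : V -> W) (g : W -> V) x v :
  differentiable f x -> differentiable g (f x) ->
  (\forall y \near x, g (f y) = y) -> 'd g (f x) ('d f x v) = v.
Proof.
move=> df dg gf; have E := congr1 (@^~ v) (diff_comp df dg).
apply: (etrans (esym E)).
have dgf := differentiable_comp df dg.
apply: (etrans (esym (deriveE v dgf))).
have -> : 'D_v (g \o f) x = 'D_v id x.
  by apply: near_eq_derive; apply: filterS gf => y /= ->.
exact: derive_id.
Qed.

Section NoImmersion.
Variables (n : nat) (S : system R n).
Hypothesis lieS : is_lie_system S.
Hypothesis sepS : low_rank_separated (VG S).

(** The matrix [J4 R] lies in sp(4) and is invertible, so its linear field is nonzero at any nonzero
    point of [U]; [diff_linvf_eq0] makes ['d F] kill this vector, although the left inverse makes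
    ['d F] injective. *)
Lemma no_related_immersion (U : set 'rV[R]_4) (F : 'rV[R]_4 -> 'rV[R]_n) :
  open U -> U !=set0 ->
  (forall x, U x -> differentiable F x) ->
  (forall x i, U x -> twice_diff_at x (fun y => F y 0 i)) ->
  (forall A, sp4 A -> exists2 Z, VG S Z &
     forall x, U x -> 'd F x (linvf A x) = Z (F x)) ->
  (forall x, U x -> exists2 G, differentiable G (F x) &
     \forall y \near x, G (F y) = y) -> False.
Proof.
move=> oU U0 dF ddF onto linv.
have [x Ux x0] := open_neq0 oU U0.
have [G dG GF] := linv _ Ux.
have sJ : sp4 (J4 R) by apply/sp4P; rewrite !J4_table oppr0.
have dFJ := diff_linvf_eq0 lieS sepS oU dF ddF onto sJ Ux.
have xJ := diff_left_inverse (linvf (J4 R) x) (dF _ Ux) dG GF.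
rewrite dFJ in xJ.
have {}xJ : x *m J4 R = 0 by rewrite -[LHS]xJ; exact: linear0.
case/eqP: x0; apply/matrixP => i j; rewrite ord1 mxE.
have E k : (x *m J4 R) 0 k = 0 by rewrite xJ mxE.
have := E 0; have := E 1; have := E 2; have := E 3.
rewrite !mulmx4E !J4_table !(mulr0, mulr1, addr0, add0r, mulrN1) => e0 e1 e2 e3.
by elim/forall_ord4: j => //; apply: oppr_inj; rewrite oppr0.
Qed.

Lemma not_eqdim_diffeo (D1 : set 'rV[R]_4) (D2 : set 'rV[R]_n) (T : system R 4) :
  (forall A, sp4 A -> VG T (linvf A)) -> ~ locally_diffeo_eqdim D1 T D2 S.
Proof.
move=> VT [_ [A [B [f [g [[_ A0 _ _] [fg [push _]]]]]]]].
have [[oA sf sg] _] := fg.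
apply: (no_related_immersion oA A0 (F := f)).
- by have [df _] := sf 1%N.
- by move=> x i Ax; apply: smooth_twice_diff oA sf Ax.
- by move=> M /VT /push.
- by move=> x; apply: diffeo_left_inverse fg.
Qed.

(** The immersion is [theta \o g]: the inverse diffeomorphism leads to the domain of the reduced
    system, and [theta] embeds that domain as a piece of a level set. *)
Lemma not_diffeo_reduced (T : system R 4) :
  (forall A, sp4 A -> VG T (linvf A)) -> ~ locally_diffeo_reduced T S.
Proof.
move=> VT [W' [X' [[_ _ [? [? [? [? [W [theta [eta [_ [_ ]]]]]]]]]]]]].
move=> [_ _ _ dth thX] [_ [A [B [f [g [[AW A0 oB _] [fg [_ push]]]]]]]].
have [[oA sf sg] [fAB gBA gf fgK]] := fg.
have [[oW' sth _] _] := dth.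
have dtheta w : W' w -> differentiable theta w by have [d _] := sth 1%N; apply: d.
have dg b : B b -> differentiable g b by move=> Bb; have [] := diffeo_inverse fg oB Bb.
have df a : A a -> differentiable f a by have [d _] := sf 1%N; apply: d.
apply: (no_related_immersion oB (F := theta \o g)).
- by have [a Aa] := A0; exists (f a); apply: fAB.
- by move=> b Bb; apply: differentiable_comp (dg _ Bb) (dtheta _ (AW _ (gBA _ Bb))).
- move=> b i Bb; have [_ ddg] := diffeo_inverse fg oB Bb.
  apply: (twice_diff_comp (G := fun y => theta y 0 i) _ ddg).
    by apply: filterS (open_nbhs_nbhs (conj oB Bb)) => y; apply: dg.
  exact: smooth_twice_diff oW' sth (AW _ (gBA _ Bb)).
(* The field of [M] is the push-forward by [f] of a combination of the [X']; ['d g] undoes ['d f],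
   and ['d theta] turns the [X'] into the fields of [S]. *)
- move=> M /VT /push[Z [c ->] ZM].
  exists (\sum_(i < sys_dim S) c i *: sys_vf S i); first by exists c.
  move=> b Bb; have Agb := gBA _ Bb; have W'gb := AW _ Agb.
  have E1 := congr1 (@^~ (linvf M b)) (diff_comp (dg _ Bb) (dtheta _ W'gb)).
  apply: (etrans E1); rewrite /=.
  have fgb : f (g b) = b := fgK _ Bb.
  have ZMb := ZM _ Agb; rewrite fgb in ZMb.
  have dgfgb : differentiable g (f (g b)) by rewrite fgb; exact: dg.
  have nA : \forall y \near g b, g (f y) = y.
    by apply: filterS (open_nbhs_nbhs (conj oA Agb)) => y; apply: gf.
  have E2 := diff_left_inverse ((\sum_(i < sys_dim S) c i *: X' i) (g b))
    (df _ Agb) dgfgb nA.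
  rewrite fgb in E2; have {}E2 := etrans (esym (congr1 ('d g b) ZMb)) E2.
  rewrite E2 !fct_sumE linear_sum; apply: eq_bigr => i _.
  rewrite -[RHS]/(c i *: sys_vf S i (theta (g b))) -(thX i _ W'gb).
  exact: linearZ.
- move=> b Bb; have Agb := gBA _ Bb; have W'gb := AW _ Agb.
  have [G dG GE] := diffeo_left_inverse dth W'gb.
  have GE0 := nbhs_singleton GE.
  have dfG : differentiable f (G (theta (g b))) by rewrite GE0; exact: df.
  exists (f \o G); first exact: (differentiable_comp dG dfG).
  have cg : g y @[y --> b] --> g b := differentiable_continuous (dg _ Bb).
  have GEg : \forall y \near b, G (theta (g y)) = g y by exact: (cg _ GE).
  have nB := open_nbhs_nbhs (conj oB Bb).
  by apply: filterS2 GEg nB => y GEy By; rewrite /= GEy; exact: fgK.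
Qed.

End NoImmersion.
End LocalDiffeomorphisms.

(** * Linear fields and quadratic Hamiltonians *)

Section LieIsomorphisms.
Variables (R : realType) (L1 L2 : lmodType R).
Variables (br1 : L1 -> L1 -> L1) (g1 : set L1) (br2 : L2 -> L2 -> L2).

Lemma is_lie_algebra_iso (g2 : set L2) Phi :
  is_lie_algebra br1 g1 -> lie_isomorphism br1 g1 br2 g2 Phi ->
  is_lie_algebra br2 g2.
Proof.
move=> [[g0 gD gbr] [brl brr brv brJ]] [[Pg _ Ps] PD Pbr].
have lift y : g2 y -> exists2 x, g1 x & y = Phi x by move=> /Ps[x gx <-]; exists x.
have P0 : Phi 0 = 0.
  have := PD 1 0 0 g0 g0; rewrite !scale1r addr0 => e.
  by apply: (addrI (Phi 0)); rewrite -e addr0.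
have PA x y : g1 x -> g1 y -> Phi (x + y) = Phi x + Phi y.
  by move=> gx gy; have := PD 1 x y gx gy; rewrite !scale1r.
have gA x y : g1 x -> g1 y -> g1 (x + y).
  by move=> gx gy; have := gD 1 x y gx gy; rewrite scale1r.
split; split.
- by rewrite -P0; apply: Pg.
- by move=> a _ _ /lift[x gx ->] /lift[y gy ->]; rewrite -PD //; apply/Pg/gD.
- by move=> _ _ /lift[x gx ->] /lift[y gy ->]; rewrite -Pbr //; apply/Pg/gbr.
- move=> a _ _ _ /lift[x gx ->] /lift[y gy ->] /lift[z gz ->].
  by rewrite -PD // -!Pbr ?brl ?PD //; [exact: gbr|exact: gbr|exact: gD].
- move=> a _ _ _ /lift[x gx ->] /lift[y gy ->] /lift[z gz ->].
  by rewrite -PD // -!Pbr ?brr ?PD //; [exact: gbr|exact: gbr|exact: gD].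
- by move=> _ /lift[x gx ->]; rewrite -Pbr // brv.
- move=> _ _ _ /lift[x gx ->] /lift[y gy ->] /lift[z gz ->].
  have gxyz := gbr _ _ gx (gbr _ _ gy gz); have gyzx := gbr _ _ gy (gbr _ _ gz gx).
  have gzxy := gbr _ _ gz (gbr _ _ gx gy); have gyz := gbr _ _ gy gz.
  have gzx := gbr _ _ gz gx; have gxy := gbr _ _ gx gy.
  by rewrite -!Pbr // -!PA ?brJ //; exact: gA.
Qed.

(** Serves both representations of sp(4), by linear fields and by quadratic functions. *)
Lemma lie_isomorphism_basis r (e : 'I_r -> L1) (Phi : L1 -> L2) :
  is_lie_algebra br1 g1 -> is_basis g1 e ->
  (forall a x y, Phi (a *: x + y) = a *: Phi x + Phi y) ->
  (forall x, g1 x -> Phi x = 0 -> x = 0) ->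
  (forall x y, g1 x -> g1 y -> Phi (br1 x y) = br2 (Phi x) (Phi y)) ->
  lie_isomorphism br1 g1 br2 (spanned (Phi \o e)) Phi /\ lin_indep (Phi \o e).
Proof.
move=> lie1 [eI g1E] PD Pinj Pbr; have [[_ gD _] _] := lie1.
have P0 : Phi 0 = 0.
  have := PD 1 0 0; rewrite !scale1r addr0 => h.
  by apply: (addrI (Phi 0)); rewrite -h addr0.
have Psum (c : 'I_r -> R) : Phi (\sum_(i < r) c i *: e i) = \sum_(i < r) c i *: Phi (e i).
  by elim/big_rec2: _ => // i y x _ <-; rewrite PD.
split; last first.
  by move=> c; rewrite -Psum => c0; apply/eI/Pinj => //; rewrite g1E; exists c.
split=> //; split.
- by move=> x; rewrite g1E => -[c ->]; exists c; rewrite Psum.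
- move=> x y /set_mem gx /set_mem gy xy; apply/eqP; rewrite -subr_eq0; apply/eqP.
  rewrite addrC -scaleN1r; apply: Pinj; first exact: gD.
  by rewrite PD xy scaleN1r addNr.
- by move=> _ [c ->]; exists (\sum_(i < r) c i *: e i); [rewrite g1E; exists c|rewrite Psum].
Qed.

End LieIsomorphisms.

(** * Smoothness, quadratic Hamiltonians and their Poisson brackets *)

Section Smoothness.
Variable R : realType.

Lemma smooth_on_cst (V W : normedModType R) (U : set V) (w : W) : smooth_on U (cst w).
Proof.
move=> k; elim: k w => [|k IH] w /=; first by move=> x _; exact: cst_continuous.
split=> [x _|v]; first exact: differentiable_cst.
by rewrite (_ : (fun x => _) = cst 0) //; apply/funext => x; exact: derive_cst.
Qed.

(** Gives smoothness by degree: the derivatives of linear maps are constant, and those of quadratic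
    forms are linear. *)
Lemma smooth_on_derive (V W : normedModType R) (U : set V) (f : V -> W) :
  (forall x, differentiable f x) -> (forall v, smooth_on U ('D_v f)) -> smooth_on U f.
Proof.
move=> df sdf [|k] /=; first by move=> x _; exact: differentiable_continuous.
by split=> // v; exact: sdf.
Qed.

Lemma smooth_linvf n (U : set 'rV[R]_n) (A : 'M[R]_n) : smooth_on U (linvf A).
Proof.
have dA x : differentiable (linvf A) x := mulmxr_differentiable A x.
apply: smooth_on_derive => // v; rewrite (_ : 'D_v _ = cst (v *m A)).
  exact: smooth_on_cst.
by apply/funext => x; apply: (etrans (deriveE v (dA x))); exact: diff_linvf.
Qed.

Lemma is_derive_mulmxr n p (C : 'M[R]_(n, p)) j (x v : 'rV[R]_n) :
  is_derive x v (fun y : 'rV[R]_n => (y *m C) 0 j) ((v *m C) 0 j).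
Proof.
have dC := mulmxr_differentiable C x.
apply: DeriveDef; first exact/diff_derivable/differentiable_coord_comp.
have E := etrans (deriveE v dC) (diff_mulmxr C x v).
by apply: (etrans (derive_coord j v dC)); exact: (congr1 (fun M : 'rV[R]_p => M 0 j) E).
Qed.

Lemma smooth_mulmxr n p (U : set 'rV[R]_n) (C : 'M[R]_(n, p)) j :
  smooth_on U (fun x : 'rV[R]_n => (x *m C) 0 j).
Proof.
apply: smooth_on_derive => [x|v].
  exact/differentiable_coord_comp/mulmxr_differentiable.
rewrite (_ : 'D_v _ = cst ((v *m C) 0 j)); first exact: smooth_on_cst.
by apply/funext => x; have [_ ->] := is_derive_mulmxr C j x v.
Qed.

Definition hamq (A : 'M[R]_4) (x : 'rV[R]_4) : R :=
  2^-1 * (x *m (A *m J4 R) *m x^T) 0 0.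

Lemma hamqE A : hamq A = 2^-1 \*: \sum_(j < 4)
  ((fun x => (x *m (A *m J4 R)) 0 j) * (fun x => (x *m 1%:M) 0 j)).
Proof.
apply/funext => x; rewrite /hamq mxE /= fct_sumE; congr (_ * _).
by apply: eq_bigr => j _; rewrite fctE mulmx1 [x^T _ _]mxE.
Qed.

Lemma hamq_differentiable A x : differentiable (hamq A) x.
Proof.
rewrite hamqE; apply: differentiableZ; apply: differentiable_sum => j.
by apply: differentiableM; apply/differentiable_coord_comp/mulmxr_differentiable.
Qed.

Lemma derive_hamq A x v : 'D_v (hamq A) x =
  (x *m (2^-1 *: (A *m J4 R + (A *m J4 R)^T) *m v^T)) 0 0.
Proof.
set B := A *m J4 R; rewrite hamqE -/B; clearbody B.
have h j := is_deriveM (is_derive_mulmxr B j x v) (is_derive_mulmxr 1%:M j x v).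
have [_ ->] := is_deriveZ (2^-1) (is_derive_sum h).
rewrite -scalemxAl -scalemxAr mxE /GRing.scale /=; congr (_ * _).
rewrite mulmxDl mulmxDr mxE big_split /= !mulmx1; congr (_ + _).
  by rewrite mulmxA [RHS]mxE; apply: eq_bigr => j _; rewrite [v^T _ _]mxE.
have -> : (x *m (B^T *m v^T)) 0 0 = (v *m B *m x^T) 0 0.
  by rewrite -trmx_mul -[x in LHS]trmxK -trmx_mul mxE.
by rewrite [RHS]mxE; apply: eq_bigr => j _; rewrite [x^T _ _]mxE [LHS]mulrC.
Qed.

Lemma smooth_hamq U A : smooth_on U (hamq A).
Proof.
apply: smooth_on_derive => [x|v]; first exact: hamq_differentiable.
rewrite (_ : 'D_v _ = fun x : 'rV[R]_4 =>
  (x *m (2^-1 *: (A *m J4 R + (A *m J4 R)^T) *m v^T)) 0 0).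
  exact: smooth_mulmxr.
by apply/funext => x; exact: derive_hamq.
Qed.

Lemma hamq_comb a A B : hamq (a *: A + B) = a *: hamq A + hamq B.
Proof.
apply/funext => x; rewrite fctE scalrfctE /hamq.
have -> : x *m ((a *: A + B) *m J4 R) *m x^T =
    a *: (x *m (A *m J4 R) *m x^T) + x *m (B *m J4 R) *m x^T.
  by rewrite !(mulmxDl, mulmxDr) -!(scalemxAl, scalemxAr).
move: (x *m (A *m _) *m _) (x *m (B *m _) *m _) => P Q.
by rewrite !mxE mulrDr mulrCA.
Qed.

Lemma omega_canE x (u v : 'rV[R]_4) : omega_can x u v = (u *m J4 R *m v^T) 0 0.
Proof.
rewrite 5!mulmx4E !J4_table ![v^T _ _]mxE /omega_can /cq1 /cq2 /cp1 /cp2; ring.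
Qed.

Section HamiltonianQuadratics.
Implicit Types A B : 'M[R]_4.

Lemma sp4_tr_mulJ A : sp4 A -> (A *m J4 R)^T = A *m J4 R.
Proof.
move=> /sp4P[[e1 e2 e3 e4] [e5 e6]]; apply/matrixP => i j; rewrite [LHS]mxE.
by elim/forall_ord4: i; elim/forall_ord4: j;
  rewrite !mulmx4E !J4_table ?e1 ?e2 ?e3 ?e4 ?e5 ?e6; ring.
Qed.

Lemma J4_mul_tr_sp4 A : sp4 A -> J4 R *m A^T = - (A *m J4 R).
Proof.
move=> sA; rewrite -(sp4_tr_mulJ sA) trmx_mul.
suff -> : (J4 R)^T = - J4 R by rewrite mulNmx opprK.
apply/matrixP => i j; rewrite [LHS]mxE [RHS]mxE.
by elim/forall_ord4: i; elim/forall_ord4: j; rewrite !J4_table ?opprK ?oppr0.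
Qed.

(** The differential of a quadratic form is given by the symmetric part of its matrix, and for [A]
    in sp(4) the matrix [A *m J4 R] is already symmetric. *)
Lemma diff_hamq A x v : sp4 A -> 'd (hamq A) x v = omega_can x (linvf A x) v.
Proof.
move=> sA; rewrite -deriveE; last exact: hamq_differentiable.
rewrite derive_hamq omega_canE (sp4_tr_mulJ sA) scalerDr -scalerDl.
by rewrite (_ : 2^-1 + 2^-1 = 1 :> R) ?scale1r ?mulmxA //; field.
Qed.

Lemma hamiltonian_linvf A : sp4 A -> hamiltonian_for (@omega_can R) (linvf A) (hamq A).
Proof.
move=> sA; split=> [|x v]; first exact: smooth_hamq.
by rewrite diff_hamq.
Qed.

Lemma omega_can_nondegenerate x (u : 'rV[R]_4) :
  (forall v, omega_can x u v = 0) -> u = 0.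
Proof.
move=> h; apply/matrixP => i j; rewrite ord1 [RHS]mxE.
have := h (delta_mx 0 0); have := h (delta_mx 0 1).
have := h (delta_mx 0 2); have := h (delta_mx 0 3).
rewrite /omega_can /cq1 /cq2 /cp1 /cp2 !mxE /=.
by elim/forall_ord4: j; lra.
Qed.

Lemma ham_vfield_hamq A x : sp4 A -> ham_vfield (@omega_can R) (hamq A) x = linvf A x.
Proof.
move=> sA; rewrite /ham_vfield.
case: xgetP => [u _ hu|/(_ (linvf A x))]; last by case=> v; rewrite diff_hamq.
apply/eqP; rewrite -subr_eq0; apply/eqP/(@omega_can_nondegenerate x) => v.
have := hu v; rewrite diff_hamq // !omega_canE !mulmxBl => e.
by rewrite [LHS]mxE [X in _ + X]mxE e subrr.
Qed.

(** The bracket at [x] is omega(xA, xB) = - x A B J x^T. Since (A B J)^T = - B A J, the symmetric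
    part of A B J is half of [A, B] J, which gives minus the Hamiltonian of the commutator. *)
Lemma poisson_hamq A B : sp4 A -> sp4 B ->
  poisson (@omega_can R) (hamq A) (hamq B) = - hamq (mx_commutator A B).
Proof.
move=> sA sB; apply/funext => x; rewrite /poisson ham_vfield_hamq // diff_hamq // omega_canE.
pose P := A *m B *m J4 R.
have BA : B *m A *m J4 R = - P^T.
  rewrite /P -[A *m B *m _]mulmxA trmx_mul (sp4_tr_mulJ sB) -[B *m _ *m A^T]mulmxA.
  by rewrite (J4_mul_tr_sp4 sA) mulmxN opprK mulmxA.
have sym : (x *m P^T *m x^T) 0 0 = (x *m P *m x^T) 0 0.
  by rewrite -[x *m P^T *m _]trmxK [LHS]mxE !trmx_mul !trmxK mulmxA.
have -> : linvf A x *m J4 R *m (linvf B x)^T = - (x *m P *m x^T).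
  rewrite /linvf trmx_mul -!mulmxA (mulmxA (J4 R)) (J4_mul_tr_sp4 sB) /P.
  by rewrite mulNmx !mulmxN !mulmxA.
rewrite -[RHS]/(- hamq (mx_commutator A B) x) /hamq /mx_commutator.
rewrite mulmxBl BA opprK -/P mulmxDr mulmxDl.
by rewrite [LHS]mxE [X in _ * X]mxE sym; field.
Qed.

End HamiltonianQuadratics.

End Smoothness.

(** * The ten given fields and Hamiltonians *)

Section MainTheorem.
Variable R : realType.

Definition matX (a : 'I_10) : 'M[R]_4 :=
  let E (i j : 'I_4) : 'M[R]_4 := delta_mx i j in
  [:: E 0 0 - E 2 2; E 0 1 - E 3 2; E 1 0 - E 2 3; E 1 1 - E 3 3;
      - E 0 2; - (E 1 2 + E 0 3); - E 1 3;
      E 2 0; E 3 0 + E 2 1; E 3 1]`_a.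

(** Coordinates of an element of sp(4) in the basis [matX], one matrix entry for each basis
    vector. *)
Definition coordX (A : 'M[R]_4) : seq R :=
  [:: A 0 0; A 0 1; A 1 0; A 1 1; - A 0 2; - A 1 2; - A 1 3; A 2 0; A 3 0; A 3 1].

Lemma vfX_linvf (a : 'I_10) : vfX a = linvf (matX a).
Proof.
apply/funext => x; apply/rowP => j; rewrite /linvf mulmx4E.
case: a => -[|[|[|[|[|[|[|[|[|[|//]]]]]]]]]] lta; rewrite /vfX /matX /= !mxE;
  by elim/forall_ord4: j; rewrite /= /cq1 /cq2 /cp1 /cp2; ring.
Qed.

Lemma hamX_hamq (a : 'I_10) : hamX a = hamq (matX a).
Proof.
apply/funext => x; rewrite /hamq mulmxA -[x *m matX a]/(linvf (matX a) x).
rewrite -(omega_canE x) -vfX_linvf /omega_can.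
by case: a => -[|[|[|[|[|[|[|[|[|[|//]]]]]]]]]] lta;
  rewrite /hamX /vfX /vec4 /cq1 /cq2 /cp1 /cp2 !mxE /=; field.
Qed.

(** This single table yields that the [matX] lie in sp(4), are independent and span it. Coefficients
    are indexed by [nat] so that they can be named by literals. *)
Lemma sum_matX (c : nat -> R) (i j : 'I_4) : (\sum_(a < 10) c a *: matX a) i j =
  (nth [::] [:: [:: c 0%N; c 1%N; - c 4%N; - c 5%N]; [:: c 2%N; c 3%N; - c 5%N; - c 6%N];
                [:: c 7%N; c 8%N; - c 0%N; - c 2%N]; [:: c 8%N; c 9%N; - c 1%N; - c 3%N]] i)`_j.
Proof.
rewrite !big_ord_recl big_ord0 /matX /= /bump /= ?add1n.
by elim/forall_ord4: i; elim/forall_ord4: j; rewrite !mxE /=; ring.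
Qed.

Lemma matX_sp4 a : sp4 (matX a).
Proof.
have -> : matX a = \sum_(i < 10) ((i == a :> nat)%:R : R) *: matX i.
  rewrite (bigD1 a) //= eqxx scale1r big1 ?addr0 // => i /negbTE.
  by rewrite -val_eqE /= => ->; rewrite scale0r.
apply/sp4P; rewrite !(sum_matX (fun n => (n == a)%:R)) /=.
by split; split; rewrite ?opprK.
Qed.

Lemma matX_basis : is_basis (@sp4 R) matX.
Proof.
split=> [c c0 i|].
  have cE : \sum_(a < 10) c a *: matX a = \sum_(a < 10) c (inord a) *: matX a.
    by apply: eq_bigr => a _; rewrite inord_val.
  have {cE c0} E (k l : 'I_4) := etrans (esym (sum_matX (fun n => c (inord n)) k l))
    (congr1 (fun M : 'M[R]_4 => M k l) (etrans (esym cE) c0)).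
  have := E 0 0; have := E 0 1; have := E 0 2; have := E 0 3; have := E 1 0.
  have := E 1 1; have := E 1 3; have := E 2 0; have := E 2 1; have := E 3 1.
  rewrite !mxE /= => e9 e8 e7 e6 e3 e2 e5 e4 e1 e0.
  rewrite -(inord_val i); case: i => -[|[|[|[|[|[|[|[|[|[|//]]]]]]]]]] lti /=; lra.
apply/seteqP; split=> [A sA|A [c ->]].
  exists (fun a => (coordX A)`_a); apply/matrixP => i j.
  have [[e1 e2 e3 e4] [e5 e6]] := (sp4P _).1 sA.
  rewrite (sum_matX (fun n => (coordX A)`_n)).
  by elim/forall_ord4: i; elim/forall_ord4: j; rewrite /= ?opprK.
have sp40 : sp4 (0 : 'M[R]_4) by rewrite /sp4 /= trmx0 mul0mx mulmx0 addr0.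
elim/big_rec: _ => // a B _ sB; apply: sp4_comb sB; exact: matX_sp4.
Qed.

Lemma sp4_lie_algebra : is_lie_algebra (@mx_commutator R (2 + 2)) (@sp4 R).
Proof.
split; split.
- by rewrite /sp4 /= trmx0 mul0mx mulmx0 addr0.
- by move=> a A B; exact: sp4_comb.
- by move=> A B; exact: sp4_comm.
- move=> a A B C _ _ _; rewrite /mx_commutator mulmxDl mulmxDr -scalemxAl -scalemxAr.
  by rewrite scalerBr opprD addrACA.
- move=> a A B C _ _ _; rewrite /mx_commutator mulmxDl mulmxDr -scalemxAl -scalemxAr.
  by rewrite scalerBr opprD addrACA.
- by move=> A _; rewrite /mx_commutator subrr.
- move=> A B C _ _ _; rewrite /mx_commutator !(mulmxBl, mulmxBr) !mulmxA.
  move: (A *m B *m C) (A *m C *m B) (B *m A *m C) (B *m C *m A) (C *m A *m B)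
    (C *m B *m A) => P1 P2 P3 P4 P5 P6.
  by apply/matrixP => i j; rewrite !mxE; ring.
Qed.

Lemma omega_can_symplectic : Defs.is_symplectic (@omega_can R).
Proof.
split; split.
- by move=> x v a u u'; rewrite /omega_can /cq1 /cq2 /cp1 /cp2 !mxE; ring.
- by move=> x v; rewrite /omega_can; ring.
- by move=> u v; exact: smooth_on_cst.
- exact: omega_can_nondegenerate.
- move=> x u v w.
  have D0 (z t s : 'rV[R]_4) : 'D_z (fun y => omega_can y t s) x = 0.
    exact: derive_cst.
  by rewrite !D0 subrr addr0.
Qed.

Lemma linvf_eq0 n (A : 'M[R]_n) : linvf A = 0 -> A = 0.
Proof.
move=> A0; apply/row_matrixP => i; rewrite row0 rowE.
exact: (congr1 (@^~ (delta_mx 0 i)) A0).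
Qed.

Lemma vfX_iso :
  lie_isomorphism (@mx_commutator R (2 + 2)) (@sp4 R)
    (@lie_bracket R 4) (spanned (@vfX R)) (@linvf R 4) /\ lin_indep (@vfX R).
Proof.
have -> : @vfX R = @linvf R 4 \o matX by apply/funext => a; exact: vfX_linvf.
apply: lie_isomorphism_basis sp4_lie_algebra matX_basis _ _ _ => [a A B|A _ A0|A B _ _].
- exact: linvf_comb.
- exact: linvf_eq0.
- by rewrite lie_bracket_linvf.
Qed.

(** By [poisson_hamq] the map [hamq] reverses brackets; composing it with negation gives a
    homomorphism. *)
Lemma hamX_iso :
  lie_isomorphism (@mx_commutator R (2 + 2)) (@sp4 R)
    (poisson (@omega_can R)) (spanned (@hamX R)) (fun A => hamq (- A)).
Proof.
have hN A : hamq (- A : 'M[R]_4) = - hamq A.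
  apply/funext => x; rewrite fctE /hamq mulNmx mulmxN mulNmx.
  by rewrite mxE mulrN.
have -> : @hamX R = (fun A => hamq (- A)) \o (fun a => - matX a).
  by apply/funext => a /=; rewrite opprK hamX_hamq.
(* The negated basis compensates the sign, so that its images are exactly the [hamX]. *)
have basisN : is_basis (@sp4 R) (fun a => - matX a).
  have [I spE] := matX_basis; split.
    move=> c c0; apply: I; apply: oppr_inj; rewrite oppr0 -sumrN -[RHS]c0.
    by apply: eq_bigr => i _; rewrite scalerN.
  rewrite spE; apply/seteqP; split=> _ [c ->]; exists (fun a => - c a);
    by apply: eq_bigr => i _; rewrite scaleNr scalerN ?opprK.
have sN (A : 'M[R]_4) : sp4 A -> sp4 (- A).
  move=> sA; rewrite -[- A]addr0 -scaleN1r; apply: sp4_comb sA _.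
  by have [[]] := sp4_lie_algebra.
apply: (lie_isomorphism_basis sp4_lie_algebra basisN _ _ _).1 => [a A B|A sA A0|A B sA sB].
- by rewrite opprD -scalerN hamq_comb.
(* A vanishing Hamiltonian has zero differential, so its linear field is zero by nondegeneracy of
   omega. *)
- apply: linvf_eq0; apply/funext => x; apply: (@omega_can_nondegenerate _ x) => v.
  rewrite -diff_hamq // -deriveE; last exact: hamq_differentiable.
  rewrite (_ : hamq A = cst 0) ?derive_cst //.
  by apply: oppr_inj; rewrite -hN A0 oppr0.
- rewrite hN poisson_hamq; [|exact: sN|exact: sN].
  by rewrite /mx_commutator !(mulNmx, mulmxN) !opprK.
Qed.

(** At [q1 = 1], [q2 = p1 = p2 = 0], the fields X_1, X_2, -X_5, -X_6 are the four coordinate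
    vectors. *)
Lemma vg_rank_X (b : 'I_10 -> R -> R) :
  vg_rank (System b (@vfX R)) (delta_mx 0 0) = 4.
Proof.
set M := \matrix_(a < 10) (vfX a (delta_mx 0 0) : 'rV[R]_4).
rewrite /vg_rank /= -/M; apply/eqP; rewrite eqn_leq rank_leq_col /=.
suff /mxrankS : (1%:M <= M)%MS by rewrite mxrank1.
apply/row_subP => i; rewrite row1.
have rM a : row a M = vfX a (delta_mx 0 0) by apply/rowP => j; rewrite !mxE.
have sub a (k : R) : delta_mx 0 i = k *: vfX a (delta_mx 0 0) ->
    ((delta_mx 0 i : 'rV[R]_4) <= M)%MS.
  by move=> ->; rewrite scalemx_sub // -rM row_sub.
elim/forall_ord4: i sub => sub.
- apply: (sub 0 1); apply/rowP; elim/forall_ord4;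
    by rewrite /vfX /vec4 /cq1 /cq2 /cp1 /cp2 !mxE /=; ring.
- apply: (sub 1 1); apply/rowP; elim/forall_ord4;
    by rewrite /vfX /vec4 /cq1 /cq2 /cp1 /cp2 !mxE /=; ring.
- apply: (sub 4 (-1)); apply/rowP; elim/forall_ord4;
    by rewrite /vfX /vec4 /cq1 /cq2 /cp1 /cp2 !mxE /=; ring.
- apply: (sub 5 (-1)); apply/rowP; elim/forall_ord4;
    by rewrite /vfX /vec4 /cq1 /cq2 /cp1 /cp2 !mxE /=; ring.
Qed.

End MainTheorem.

Theorem mainTheorem5 (R : realType) (b : 'I_10 -> R -> R)
    (hb : forall a, smooth_on setT (b a)) :
  let X := System b (@vfX R) in
  [/\ is_lie_hamilton (@omega_can R) X,
      lie_isomorphic (@mx_commutator R (2 + 2)) (@sp4 R)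
        (@lie_bracket R 4) (VG X),
      forall a, hamiltonian_for (@omega_can R) (@vfX R a) (@hamX R a) &
      is_lie_algebra (poisson (@omega_can R)) (spanned (@hamX R)) /\
      lie_isomorphic (@mx_commutator R (2 + 2)) (@sp4 R)
        (poisson (@omega_can R)) (spanned (@hamX R))] /\
  (forall (n : nat) (Y : system R n), (1 <= n <= 3)%N ->
     is_lie_system Y -> ~ locally_diffeomorphic X Y) /\
  (forall (n : nat) (Y : system R n),
     uncoupled_sum_low Y -> ~ locally_diffeomorphic X Y).
Proof.
move=> X; have [vfX_isoP vfX_indep] := vfX_iso R.
have vfX_ham a : hamiltonian_for (@omega_can R) (@vfX R a) (@hamX R a).
  by rewrite vfX_linvf hamX_hamq; apply/hamiltonian_linvf/matX_sp4.
have VGX A : sp4 A -> VG X (linvf A) by have [[VA _ _] _ _] := vfX_isoP; exact: VA.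
(* A reduction to dimension [n] bounds the rank by [n] at every point, and one point of rank 4
   contradicts this. *)
have not_reduced n (Y : system R n) : (n < 4)%N -> ~ locally_diffeo_reduced Y X.
  move=> n4 [W' [X' [[_ /(_ (delta_mx 0 0)) rk _] _]]].
  by move: rk; rewrite vg_rank_X leqNgt n4.
split; [split|split].
- split; first exact: omega_can_symplectic.
    split=> // [a|]; first by rewrite /= vfX_linvf; exact: smooth_linvf.
    exact: is_lie_algebra_iso (sp4_lie_algebra R) vfX_isoP.
  by move=> a; exists (hamX a); exact: vfX_ham.
- by exists (@linvf R 4).
- exact: vfX_ham.
- split; first exact: is_lie_algebra_iso (sp4_lie_algebra R) (hamX_iso R).
  by exists (fun A => hamq (- A)); exact: hamX_iso.
- move=> n Y /andP[_ n3] _ [[n4 _]|[n4 _]|[_]]; last exact: not_reduced.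
    by rewrite -n4 in n3.
  by move: n4; rewrite ltnNge (leq_trans n3).
(* The three cases are [Y] of dimension 4, of larger dimension (then [Y] is reduced), and of smaller
   dimension (then [X] would be). *)
- move=> n Y /uncoupled_sum_separated[lieY sepY] [|[_]|[n4]].
  + exact: (@not_eqdim_diffeo _ _ _ lieY sepY _ _ _ VGX).
  + exact: (@not_diffeo_reduced _ _ _ lieY sepY _ VGX).
  + exact: not_reduced.
Qed.
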